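(* Let $T_b\ge 0$ be a given constant and let $\psi_b=\psi_b(\mu)\ge 0$, $\mu\in(0,1]$, be a given function. Then there exists a bounded non-negative weak solution $(T,\psi)\in L^2_{\rm loc}(\mathbb{R}_+)\times L^2_{\rm loc}(\mathbb{R}_+\times[-1,1])$ of $$\partial_x^2 T+\langle \psi-T^4\rangle=0,\qquad \mu\,\partial_x\psi+(\psi-T^4)=0,\qquad (x,\mu)\in\mathbb{R}_+\times[-1,1],$$ with boundary conditions $T(0)=T_b$ and $\psi(0,\mu)=\psi_b(\mu)$ for $\mu\in(0,1]$, and the solution satisfies, for every $0\le\alpha<1$, $$\int_0^\infty e^{2\alpha x}4T^3|\partial_xT|^2dx+(1-\alpha)\int_0^\infty\int_{-1}^1e^{2\alpha x}(\psi-T^4)^2d\mu dx+\frac12\int_{-1}^0|\mu|(\psi(0,\mu)-T_b^4)^2d\mu\le\frac12\int_0^1\mu(\psi_b-T_b^4)^2d\mu .$$ Moreover, there exists a constant $T_\infty\ge0$ such that, for every $0<\alpha<1$ and every $x\in\mathbb{R}_+$, with $$M_\alpha=\frac{1}{\sqrt{6\alpha(1-\alpha)}}\left(\int_0^1\mu(\psi_b-T_b^4)^2d\mu\right)^{1/2},$$ one has $$|T(x)-T_\infty|\le M_\alpha e^{-\alpha x},$$ $$|\psi(x,\mu)-T_\infty^4|\le|\psi_b(\mu)-T_b^4|e^{-x/\mu}+4(T_b+2M_\alpha)^3M_\alpha\frac{1}{1-\mu\alpha}e^{-\alpha x}\quad\text{for }\mu>0,$$ $$|\psi(x,\mu)-T_\infty^4|\le4(T_b+2M_\alpha)^3M_\alpha\frac{1}{1-\mu\alpha}e^{-\alpha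 x}\quad\text{for }\mu<0 .$$ As a consequence, $T_\infty\le T_b+M_\alpha$ and $|T(x)|\le T_b+2M_\alpha$.
   Context: Here $T=T(x)$ and $\psi=\psi(x,\mu)$ with $x\in\mathbb{R}_+$ (the half-line), $\mu\in[-1,1]$, and $\langle f\rangle:=\int_{-1}^1f(\mu)\,d\mu$. Weak solution means that the two equations hold in the weak sense (integrated against $C^1$ test functions), and that the boundary conditions at $x=0$ hold in the sense of traces; $\psi(0,\mu)$ for $\mu<0$ denotes the trace of $\psi$ at $x=0$.
   Formalization: The given function ψ_b is additionally assumed measurable and essentially bounded on (0,1]; without this no bounded solution ψ can exist, e.g. for T_b=0 and ψ_b(μ)=μ^{-1/2}, since ψ(x,μ) ≥ ψ_b(μ)e^{-x/μ}. *)

(* Defs.v *)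
From HB Require Import structures.
From mathcomp Require Export all_boot all_order all_algebra.
From mathcomp Require Export all_classical all_reals all_analysis.
Set Implicit Arguments.
Unset Strict Implicit.
Unset Printing Implicit Defensive.
Export Order.TTheory GRing.Theory Num.Theory.
Export numFieldNormedType.Exports.

Local Open Scope classical_set_scope.
Local Open Scope ring_scope.

(* Functions of x in R_+, of mu in [-1,1] and of (x,mu) are total functions on
   R, R and R * R; only their values on the sets below matter. *)
Section milne.
Context {R : realType}.

Notation leb := (@lebesgue_measure R).
Notation leb2 := (leb \x leb)%E.
Implicit Types (T dT phi g : R -> R) (psi f Phi : R * R -> R).

Definition half_line : set R := `[0, +oo[.
Definition directions : set R := `[-1, 1].
Definition incoming : set R := `]0, 1].
Definition phase_space : set (R * R) := half_line `*` directions.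

Definition average (f : R -> R) : R := \int[leb]_(mu in directions) f mu.

(* The half-line is closed at 0, so "loc" means square integrable up to x = 0,
   which is what traces at x = 0 require. *)
Definition L2loc1 T : Prop :=
  measurable_fun half_line T /\
  forall b : R, (\int[leb]_(x in `[0%R, b]) ((T x) ^+ 2)%:E < +oo)%E.

Definition L2loc2 f : Prop :=
  measurable_fun phase_space f /\
  forall b : R,
    (\int[leb2]_(z in `[0%R, b] `*` directions) ((f z) ^+ 2)%:E < +oo)%E.

Definition C1_1 phi : Prop :=
  (forall x, derivable phi x 1) /\ continuous (derive1 phi).

Definition dx Phi (z : R * R) : R := 'D_(1, 0) Phi z.
Definition dmu Phi (z : R * R) : R := 'D_(0, 1) Phi z.

Definition C1_2 Phi : Prop :=
  [/\ continuous Phi,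
      forall z, derivable Phi z (1, 0),
      forall z, derivable Phi z (0, 1),
      continuous (dx Phi) & continuous (dmu Phi)].

(* C^1 functions with compact support in ]0, +oo[, resp. in ]0, +oo[ x [-1,1]:
   they may be nonzero at mu = -1 and mu = 1, but vanish near x = 0. *)
Definition test1 phi : Prop :=
  C1_1 phi /\ exists a b : R, 0 < a /\
    forall x, ~ (a <= x <= b) -> phi x = 0.

Definition test2 Phi : Prop :=
  C1_2 Phi /\ exists a b : R, 0 < a /\
    forall x mu, ~ (a <= x <= b) -> Phi (x, mu) = 0.

(* The same, with compact support in [0, +oo[, resp. [0, +oo[ x [-1,1]. *)
Definition test1_bd phi : Prop :=
  C1_1 phi /\ exists b : R, forall x, b <= x -> phi x = 0.

Definition test2_bd Phi : Prop :=
  C1_2 Phi /\ exists b : R, forall x mu, b <= x -> Phi (x, mu) = 0.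

Definition weak_derivative T dT : Prop :=
  forall phi, test1 phi ->
    \int[leb]_(x in half_line) (T x * derive1 phi x) =
    - \int[leb]_(x in half_line) (dT x * phi x).

(* d_x^2 T + <psi - T^4> = 0, where dT is the weak derivative d_x T. *)
Definition weak_heat_equation T dT psi : Prop :=
  forall phi, test1 phi ->
    \int[leb]_(x in half_line) (dT x * derive1 phi x) =
    \int[leb]_(x in half_line)
       (average (fun mu => psi (x, mu) - T x ^+ 4) * phi x).

(* mu d_x psi = h. *)
Definition weak_transport_equation psi (h : R * R -> R) : Prop :=
  forall Phi, test2 Phi ->
    \int[leb2]_(z in phase_space) (z.2 * psi z * dx Phi z) =
    - \int[leb2]_(z in phase_space) (h z * Phi z).

(* c is the trace at x = 0 of T, whose weak derivative is dT: Green's formula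
   on the half-line. *)
Definition trace1 T dT (c : R) : Prop :=
  forall phi, test1_bd phi ->
    \int[leb]_(x in half_line) (T x * derive1 phi x + dT x * phi x) =
    - (c * phi 0).

(* g is the trace at x = 0 of psi, where mu d_x psi = h weakly: g belongs to
   L^2([-1,1], |mu| dmu) and Green's formula holds. *)
Definition trace2 psi (h : R * R -> R) g : Prop :=
  [/\ measurable_fun directions g,
      (\int[leb]_(mu in directions) (`|mu| * (g mu) ^+ 2)%:E < +oo)%E
    & forall Phi, test2_bd Phi ->
        \int[leb2]_(z in phase_space) (z.2 * psi z * dx Phi z + h z * Phi z) =
        - \int[leb]_(mu in directions) (mu * g mu * Phi (0, mu))].

Definition bounded_nonneg T psi : Prop :=
  [/\ forall x, half_line x -> 0 <= T x,
      forall z, phase_space z -> 0 <= psi z,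
      exists C : R, forall x, half_line x -> T x <= C
    & exists C : R, {ae leb2, forall z, phase_space z -> psi z <= C}].

(* The representatives of the classes T and psi that give a meaning to T x and
   psi (x, mu) for every x >= 0, including x = 0. *)
Definition continuous_representatives T psi : Prop :=
  {within half_line, continuous T} /\
  forall mu, directions mu -> mu != 0 ->
    {within half_line, continuous (fun x => psi (x, mu))}.

Definition milne_solution (Tb : R) (psib : R -> R) T dT psi : Prop :=
  let h := fun z : R * R => T z.1 ^+ 4 - psi z in
  [/\ [/\ L2loc1 T, L2loc1 dT, L2loc2 psi & continuous_representatives T psi],
      weak_derivative T dT,
      weak_heat_equation T dT psi,
      weak_transport_equation psi h
    & [/\ trace1 T dT (T 0), trace2 psi h (fun mu => psi (0, mu)),
          T 0 = Tb & forall mu, 0 < mu <= 1 -> psi (0, mu) = psib mu]].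

Definition boundary_energy (Tb : R) (psib : R -> R) : R :=
  \int[leb]_(mu in incoming) (mu * (psib mu - Tb ^+ 4) ^+ 2).

Definition decay_const (Tb : R) (psib : R -> R) (alpha : R) : R :=
  (Num.sqrt (6 * alpha * (1 - alpha)))^-1 * Num.sqrt (boundary_energy Tb psib).

(* Extended-real integrals of nonnegative functions: the inequality includes
   the finiteness of each term. *)
Definition energy_estimate (Tb : R) (psib : R -> R) T dT psi (alpha : R)
    : Prop :=
  (\int[leb]_(x in half_line)
      (expR (2 * alpha * x) * (4 * T x ^+ 3 * `|dT x| ^+ 2))%:E
   + (1 - alpha)%:E *
     \int[leb]_(x in half_line) \int[leb]_(mu in directions)
        (expR (2 * alpha * x) * (psi (x, mu) - T x ^+ 4) ^+ 2)%:E
   + (2^-1)%:E *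
     \int[leb]_(mu in `[(-1)%R, 0%R]) (`|mu| * (psi (0%R, mu) - Tb ^+ 4) ^+ 2)%:E
   <= (2^-1 * boundary_energy Tb psib)%:E)%E.

End milne.

(* Main.v *)
Require Import Defs.
From mathcomp Require Import ring lra measurable_realfun.

(* For a given temperature the intensity is explicit: with S = T^4, psi(., mu)
   is the solution of mu u' + u = S fed by psi_b when mu > 0 and bounded when
   mu < 0.  The heat equation becomes T'' = k^2 (T - q[T]), where
   q[T] = T + (<psi> - 2 T^4) / k^2, and it factors as T + T'/k = w,
   w - w'/k = q[T].  For k large T |-> q[T] is monotone and preserves
   0 <= T <= C, so the Picard iterates starting from 0 increase to a bounded
   solution.

   The flux T' - <mu psi> is constant, and it vanishes because T + <mu^2 psi>
   is bounded with this constant as its slope.  Then E = <mu (psi - T^4)^2>/2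
   satisfies E' = - 4 T^3 T'^2 - <(psi - T^4)^2> <= - 2 |E|, and being bounded
   it is nonnegative.  Multiplying by e^{2 alpha x} gives the energy estimate,
   and T' = <mu (psi - T^4)> together with Young's inequality turns it into the
   exponential decay of T; the bounds on psi follow by comparison. *)

Set Implicit Arguments.
Unset Strict Implicit.
Unset Printing Implicit Defensive.

Local Open Scope classical_set_scope.
Local Open Scope ring_scope.

(** * Calculus on the half-line *)

(** The datum is only essentially bounded, while [psi] has a value in every direction. Uniform
    bounds on the intensity are therefore stated on a set [D] of full measure in [-1, 1] that avoids
    mu = 0 and the directions where the bound on the datum fails; averages over [D] and over [-1, 1]
    agree. At fixed mu everything is an ordinary differential argument in x, and integral estimates
    appear as monotonicity of a well chosen function. The derivative (T^4 - psi) / mu is singular as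
    mu tends to 0, so under the average only quantities carrying a factor mu are differentiated. The
    bound C of the iteration depends on the supremum of psi_b and must not enter the final
    estimates. It serves qualitative facts only (zero flux, sign of E); the quantitative ones start
    from E(0), which is at most half the incoming energy. In M_alpha, the 6 is 3 * 2: the 3 comes
    from <mu^2> = 2/3, the 2 from integrating e^{-2 alpha x}. The factor 1 - alpha is the share of
    the dissipation that survives differentiation of the weight e^{2 alpha x}. *)

Section half_line_calculus.
Context {R : realType}.
Implicit Types (u v d e phi : R -> R) (x y : R).
Notation leb := (@lebesgue_measure R).

(* Nothing is asked of the derivative at x <= 0: functions on the half-line are
   extended to x < 0 by composition with max(x, 0). *)
Definition half_C1 u d :=
  [/\ continuous u, continuous d & forall x, 0 < x -> is_derive x 1 u (d x)].

Lemma half_C1_cst (c : R) : half_C1 (fun=> c) (fun=> 0).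
Proof.
split; [exact: cst_continuous|exact: cst_continuous|].
by move=> x _; exact: is_derive_cst.
Qed.

Lemma half_C1_id : half_C1 (fun x => x) (fun=> 1).
Proof.
split; [by move=> x; exact: cvg_id|exact: cst_continuous|].
by move=> x _; exact: is_derive_id.
Qed.

Lemma half_C1D u d v e : half_C1 u d -> half_C1 v e ->
  half_C1 (fun x => u x + v x) (fun x => d x + e x).
Proof.
move=> [cu cd du] [cv ce dv]; split.
- by move=> x; apply: cvgD; [exact: cu|exact: cv].
- by move=> x; apply: cvgD; [exact: cd|exact: ce].
- by move=> x x0; apply: is_deriveD; [exact: du|exact: dv].
Qed.

Lemma half_C1M u d v e : half_C1 u d -> half_C1 v e ->
  half_C1 (fun x => u x * v x) (fun x => d x * v x + u x * e x).
Proof.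
move=> [cu cd du] [cv ce dv]; split.
- by move=> x; apply: cvgM; [exact: cu|exact: cv].
- by move=> x; apply: cvgD; apply: cvgM; [exact: cd|exact: cv|exact: cu|exact: ce].
- move=> x x0; have h1 := du x x0; have h2 := dv x x0.
  have -> : d x * v x + u x * e x = u x *: e x + v x *: d x.
    by rewrite /GRing.scale/= addrC [v x * _]mulrC.
  exact: is_deriveM.
Qed.

Lemma half_C1_eq u d e : half_C1 u d -> d =1 e -> half_C1 u e.
Proof. by move=> h /funext <-. Qed.

Lemma half_C1_eqfun u v d : half_C1 u d -> u =1 v -> half_C1 v d.
Proof. by move=> h /funext <-. Qed.

Lemma half_C1Z (c : R) u d : half_C1 u d ->
  half_C1 (fun x => c * u x) (fun x => c * d x).
Proof.
move=> h; apply: half_C1_eq (half_C1M (half_C1_cst c) h) _ => x /=.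
by rewrite mul0r add0r.
Qed.

Lemma half_C1B u d v e : half_C1 u d -> half_C1 v e ->
  half_C1 (fun x => u x - v x) (fun x => d x - e x).
Proof.
move=> hu hv; have := half_C1D hu (half_C1Z (-1) hv).
move=> h.
apply: (@half_C1_eq _ (fun x => d x + -1 * e x)) => [|x]; last by rewrite mulN1r.
by apply: half_C1_eqfun h _ => x; rewrite mulN1r.
Qed.

Lemma half_C1X u d n : half_C1 u d ->
  half_C1 (fun x => u x ^+ n.+1) (fun x => n.+1%:R * u x ^+ n * d x).
Proof.
move=> hu; elim: n => [|n IH].
  apply: half_C1_eq hu _ => x; by rewrite expr0 !mul1r.
apply: (@half_C1_eqfun (fun x => u x * u x ^+ n.+1)) => [|x]; last by rewrite [RHS]exprS.
apply: half_C1_eq (half_C1M hu IH) _ => x /=.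
rewrite -[in RHS](@natr1 _ n.+1) !exprS; ring.
Qed.

Lemma half_C1_expR (a : R) :
  half_C1 (fun x => expR (a * x)) (fun x => a * expR (a * x)).
Proof.
have c : continuous (fun x => expR (a * x)).
  move=> x; apply: continuous_comp; last exact: continuous_expR.
  exact: mulrl_continuous.
split => //.
- by move=> x; apply: cvgM; [exact: cvg_cst|exact: c].
- move=> x _; apply: is_derive_eq.
  by rewrite /GRing.scale/= mulr1 mulrC.
Qed.

Lemma half_C1_within u d (A : set R) : half_C1 u d -> {within A, continuous u}.
Proof. by move=> [cu _ _]; exact: continuous_subspaceT. Qed.

Lemma half_C1_le0 u d : half_C1 u d -> (forall x, 0 < x -> d x <= 0) ->
  forall x y, 0 <= x -> x <= y -> u y <= u x.
Proof.
move=> hu d0 x y x0 xy; have [_ _ du] := hu.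
apply: (@ler0_derive1_nincry _ u 0) => //.
- move=> z; rewrite in_itv/= andbT => z0.
  by have := du z z0 => -[].
- move=> z; rewrite in_itv/= andbT => z0.
  by rewrite derive1E; have /(@derive_val _ _ _) -> := du z z0; exact: d0.
- exact: half_C1_within hu.
Qed.

Lemma half_C1_cst0 u d : half_C1 u d -> (forall x, 0 < x -> d x = 0) ->
  forall x, 0 <= x -> u x = u 0.
Proof.
move=> hu d0 x x0; apply/eqP; rewrite eq_le; apply/andP; split.
  by apply: (half_C1_le0 hu) => // z z0; rewrite d0.
rewrite -lerN2 -!(mulN1r (u _)).
apply: (half_C1_le0 (half_C1Z (-1) hu)) => // z z0.
by rewrite d0// mulr0.
Qed.

(* e^{cx} u is nonincreasing and tends to 0, since u is bounded and c < 0. *)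
Lemma half_C1_bounded_ge0 u d (c B : R) : half_C1 u d -> c < 0 ->
  (forall x, 0 <= x -> `|u x| <= B) ->
  (forall x, 0 < x -> d x + c * u x <= 0) ->
  forall x, 0 <= x -> 0 <= u x.
Proof.
move=> hu c0 ub dle x x0.
have hw := half_C1M (half_C1_expR c) hu.
have mono y : x <= y -> expR (c * y) * u y <= expR (c * x) * u x.
  move=> xy; apply: (half_C1_le0 hw) => // z z0.
  have -> : c * expR (c * z) * u z + expR (c * z) * d z =
    expR (c * z) * (d z + c * u z) by ring.
  by apply: mulr_ge0_le0; [exact: expR_ge0|exact: dle].
rewrite leNgt; apply/negP => ux0.
have B0 : 0 <= B by apply: le_trans (ub 0 (lexx _)); exact: normr_ge0.
have eux : 0 < - (expR (c * x) * u x).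
  by rewrite -mulrN mulr_gt0 ?expR_gt0 ?oppr_gt0.
pose t := - (expR (c * x) * u x).
(* Monotonicity forces t e^{-cy} <= B for all y >= x, whereas e^{-cy} >= 1 - c y makes the left side
   at least t + B + 1 at this point. The 1 keeps [y] positive even when B = 0. *)
pose y := Num.max x ((B + 1) / (t * - c)).
have tc : 0 < t * - c by apply: mulr_gt0 => //; rewrite oppr_gt0.
have xy : x <= y by rewrite le_max lexx.
have y0 : 0 < y.
  rewrite lt_max; apply/orP; right; rewrite divr_gt0//.
  by rewrite ltr_wpDl.
have := mono y xy; rewrite leNgt => /negP; apply.
have h1 : - B <= u y by have := ub y (ltW y0); rewrite ler_norml => /andP[].
have h2 : t <= expR (c * y) * B -> False.
  have e1 : 1 + - c * y <= expR (- (c * y)) by rewrite -mulNr expR_ge1Dx.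
  have : B + 1 <= t * - c * y.
    rewrite mulrC -ler_pdivrMr//; by rewrite le_max lexx orbT.
  move=> h3 h4.
  have : t * expR (- (c * y)) <= B.
    by rewrite expRN ler_pdivrMr ?expR_gt0// mulrC.
  apply/negP; rewrite -ltNge.
  apply: (@lt_le_trans _ _ (t * (1 + - c * y))); last by rewrite ler_wpM2l// ltW.
  rewrite mulrDr mulr1 mulrA.
  by rewrite (@lt_le_trans _ _ (B + 1))// ?ltrDl// ler_wpDl// ltW.
rewrite ltNge; apply/negP => h5; apply: h2.
rewrite /t lerNl; apply: le_trans h5.
by rewrite -mulrN ler_wpM2l ?expR_ge0.
Qed.

Lemma continuous_clip : continuous (fun x => Num.max x 0).
Proof.
by move=> x; apply: continuous_max; [exact: cvg_id|exact: cvg_cst].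
Qed.

(** The derivative is clipped along with the function, which keeps it continuous on the whole line;
    near a point x > 0 the clip is the identity. Clipping also keeps e^{-x/mu} bounded for x < 0. *)
Lemma half_C1_clip u d : half_C1 u d ->
  half_C1 (fun x => u (Num.max x 0)) (fun x => d (Num.max x 0)).
Proof.
move=> [cu cd du]; split.
- move=> x; apply: (@continuous_comp _ _ _ (fun x => Num.max x 0) u).
    exact: continuous_clip.
  exact: cu.
- move=> x; apply: (@continuous_comp _ _ _ (fun x => Num.max x 0) d).
    exact: continuous_clip.
  exact: cd.
- move=> x x0; rewrite (max_idPl (ltW x0)).
  apply: (@near_eq_is_derive _ _ _ u); last exact: du.
  near=> y; rewrite /= (_ : Num.max y 0 = y)//; apply/max_idPl.
  by near: y; exact: lt_le_nbhsr.
Unshelve. all: end_near. Qed.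

End half_line_calculus.

(** * Integrals depending on a parameter, and Green's formula on the half-line *)

Section bounded_integration.
Context {R : realType}.
Implicit Types (D : set R).
Notation leb := (@lebesgue_measure R).

Lemma bounded_integrable d (X : measurableType d) (m : {measure set X -> \bar R})
    (D : set X) (f : X -> R) (C : R) :
  measurable D -> (m D < +oo)%E -> measurable_fun D f ->
  (forall x, D x -> `|f x| <= C) -> m.-integrable D (EFin \o f).
Proof.
move=> mD Doo mf fC; apply: measurable_bounded_integrable => //.
exists C; split; first exact: num_real.
by move=> y Cy x Dx; apply: le_trans (ltW Cy); exact: fC.
Qed.

Arguments bounded_integrable {d X} m {D f C}.

Lemma continuous_Rintegral D (f : R -> R -> R) (C : R) :
  measurable D -> (leb D < +oo)%E -> (forall x, measurable_fun D (f x)) ->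
  (forall x mu, D mu -> `|f x mu| <= C) ->
  (forall mu, D mu -> continuous (f ^~ mu)) ->
  continuous (fun x => \int[leb]_(mu in D) f x mu).
Proof.
move=> mD Doo mf fC cf a.
apply: (@continuity_under_integral _ _ _ leb f D mD (a - 1) (a + 1) _ _
  (cst `|C|)) => //.
- by move=> x _; exact: (bounded_integrable leb mD Doo (mf x) (fC x)).
- by apply: aeW => y Dy z _; exact: (cf y Dy z).
- apply: (@bounded_integrable _ _ leb _ _ `|C|) => //.
  by move=> x _; rewrite normr_id.
- move=> x _; apply: aeW => y Dy; exact: le_trans (fC _ _ Dy) (ler_norm _).
- by rewrite inE/= in_itv/= ltrBlDr !ltrDl ltr01.
Qed.

(** The derivative must be bounded uniformly in mu, which (S - psi) / mu is not. The lemma is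
    therefore applied to integrands with a factor mu, which cancels the singularity. Differentiation
    takes place on ]0, a + 1[, where the pointwise derivative is known. *)
Lemma half_C1_Rintegral D (g d : R -> R -> R) (C : R) :
  measurable D -> (leb D < +oo)%E ->
  (forall x, measurable_fun D (g x)) -> (forall x, measurable_fun D (d x)) ->
  (forall x mu, D mu -> `|g x mu| <= C) ->
  (forall x mu, D mu -> `|d x mu| <= C) ->
  (forall mu, D mu -> half_C1 (g ^~ mu) (d ^~ mu)) ->
  half_C1 (fun x => \int[leb]_(mu in D) g x mu)
          (fun x => \int[leb]_(mu in D) d x mu).
Proof.
move=> mD Doo mg md gC dC gd.
have intC : leb.-integrable D (EFin \o (cst `|C|)).
  apply: (@bounded_integrable _ _ leb _ _ `|C|) => //.
  by move=> x _; rewrite normr_id.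
split.
- by apply: (@continuous_Rintegral _ _ C) => // mu Dmu; have [] := gd mu Dmu.
- by apply: (@continuous_Rintegral _ _ C) => // mu Dmu; have [] := gd mu Dmu.
- move=> a a0.
  have ia : `]0%R, (a + 1)%R[%classic a by rewrite /= in_itv/= a0 ltrDl ltr01.
  have der x mu : `]0%R, (a + 1)%R[%classic x -> D mu ->
      is_derive x 1 (g ^~ mu) (d x mu).
    by rewrite /= in_itv/= => /andP[x0 _] /gd[_ _]; exact.
  have intg x : `]0%R, (a + 1)%R[%classic x -> leb.-integrable D (EFin \o g x).
    by move=> _; exact: (bounded_integrable leb mD Doo (mg x) (gC x)).
  have der1 x mu : `]0%R, (a + 1)%R[%classic x -> D mu -> derivable (g ^~ mu) x 1.
    by move=> xI Dmu; have [] := der x mu xI Dmu.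
  have derE x mu : `]0%R, (a + 1)%R[%classic x -> D mu -> partial1of2 g x mu = d x mu.
    move=> xI Dmu; rewrite partial1of2E.
    by apply: (@derive_val _ _ _ _ _ _ _ (der x mu xI Dmu)).
  have ub x mu : `]0%R, (a + 1)%R[%classic x -> D mu -> `|partial1of2 g x mu| <= cst `|C| mu.
    by move=> xI Dmu; rewrite derE// (le_trans (dC _ _ Dmu))// ler_norm.
  have nC : forall y : R, 0 <= cst `|C| y by move=> y; exact: normr_ge0.
  apply: DeriveDef.
    exact: (derivable_under_integral (mu := leb) mD ia intg der1 nC intC ub).
  rewrite -derive1E (differentiation_under_integral (mu := leb) mD ia intg der1 nC intC ub).
  by apply: eq_Rintegral => mu; rewrite inE => Dmu; rewrite derE.
Qed.

Lemma derive1_eq0_beyond (phi : R -> R) (b x : R) :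
  (forall y, b <= y -> phi y = 0) -> b < x -> derive1 phi x = 0.
Proof.
move=> phib bx; rewrite derive1E (@near_eq_derive _ _ _ phi (cst 0)).
  by rewrite derive_cst.
by near=> y; rewrite /= phib//; near: y; exact: lt_le_nbhsr.
Unshelve. all: end_near. Qed.

Lemma green_half_line (u d phi : R -> R) : half_C1 u d -> test1_bd phi ->
  \int[leb]_(x in half_line) (u x * derive1 phi x + d x * phi x) =
  - (u 0 * phi 0).
Proof.
move=> [cu cd du] [[dphi cphi'] [b0 phib0]].
(* The 1 makes [b] positive, as the fundamental theorem on [0, b] requires, and strictly larger than
   [b0], so that [phi] and its derivative both vanish beyond [b]. *)
pose b := Num.max b0 0 + 1.
have b_gt0 : 0 < b by rewrite /b ltr_wpDl// le_max lexx orbT.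
have b0b : b0 < b by rewrite /b ltr_pwDr// le_max lexx.
have phib x : b0 <= x -> phi x = 0 by exact: phib0.
have cphi : continuous phi.
  by move=> x; apply: differentiable_continuous; exact/derivable1_diffP.
have phi'b x : b0 < x -> derive1 phi x = 0 by exact: derive1_eq0_beyond.
have F' (x : R) : 0 < x ->
    is_derive x 1 (fun x => u x * phi x) (u x * derive1 phi x + d x * phi x).
  move=> x0; have h1 := du x x0.
  have h2 : is_derive x 1 phi (derive1 phi x).
    by apply: DeriveDef => //; rewrite derive1E.
  have -> : u x * derive1 phi x + d x * phi x =
    u x *: derive1 phi x + phi x *: d x.
    by rewrite /GRing.scale/= [phi x * _]mulrC.
  exact: is_deriveM.
have cF : continuous (fun x => u x * phi x).
  by move=> x; apply: cvgM; [exact: cu|exact: cphi].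
have cf : continuous (fun x => u x * derive1 phi x + d x * phi x).
  move=> x; apply: cvgD; apply: cvgM.
  - exact: cu.
  - exact: cphi'.
  - exact: cd.
  - exact: cphi.
transitivity (\int[leb]_(x in `[0, b]) (u x * derive1 phi x + d x * phi x)).
  rewrite Rintegral_mkcond [RHS]Rintegral_mkcond; apply: eq_Rintegral => x _.
  rewrite !patchE /half_line; case: ifPn => xh; case: ifPn => xb //.
  - have bx : b < x.
      rewrite ltNge; apply/negP => xb'; move/negP: xb; apply.
      by move: xh; rewrite !inE/= !in_itv/= andbT => ->.
    by rewrite phib ?(ltW (lt_trans b0b bx))// phi'b ?(lt_trans b0b bx)// !mulr0 addr0.
  - by move: xh xb; rewrite notin_setE inE/= !in_itv/= andbT => + /andP[].
rewrite /Rintegral (@continuous_FTC2 _ _ (fun x => u x * phi x))//.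
- by rewrite phib ?(ltW b0b)// mulr0 sub0e.
- exact: continuous_subspaceT.
- split.
  + by move=> x; rewrite in_itv/= => /andP[x0 _]; have [] := F' x x0.
  + exact/cvg_at_right_filter/cF.
  + exact/cvg_at_left_filter/cF.
- move=> x; rewrite in_itv/= => /andP[x0 _]; rewrite derive1E.
  exact: (@derive_val _ _ _ _ _ _ _ (F' x x0)).
Qed.

End bounded_integration.

(** * The attenuation kernel *)

Section sweep.
Context {R : realType}.
Implicit Types (f g : R -> R) (x mu s C : R).
Notation leb := (@lebesgue_measure R).

Lemma measurable_inv : measurable_fun setT (fun x : R => x^-1).
Proof.
have -> : [set: R] = [set 0] `|` ~` [set 0] by rewrite setUv.
have m0 : measurable (~` [set (0 : R)]) by exact: measurableC.
apply/measurable_funU => //; split; first exact: measurable_fun_set1.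
apply: open_continuous_measurable_fun.
  by apply: closed_openC; exact: closed_eq.
move=> x; rewrite inE/= => /eqP x0; exact: inv_continuous.
Qed.

(* Green kernel of mu u' + u = f with u(0) = 0 if mu > 0, u bounded if mu < 0;
   the junk value at mu = 0 is 0. *)
Definition kern x mu s : R :=
  if (0 < mu) && (s <= x) || (mu < 0) && (x <= s)
  then `|mu|^-1 * expR ((s - x) / mu) else 0.

(** The domain of integration is the same for all x and mu, the case split being left to [kern];
    joint measurability in (x, mu) then follows from Tonelli's theorem. *)
Definition sweep f x mu : R :=
  \int[leb]_(s in half_line) (kern (Num.max x 0) mu s * f s).

Definition bmf C f := measurable_fun setT f /\ forall x, 0 <= f x <= C.

Lemma kern_ge0 x mu s : 0 <= kern x mu s.
Proof.
by rewrite /kern; case: ifP => // _; rewrite mulr_ge0 ?expR_ge0// invr_ge0.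
Qed.

Lemma measurable_kern :
  measurable_fun setT (fun z : R * R * R => kern z.1.1 z.1.2 z.2).
Proof.
have m1 : measurable_fun setT (fun z : R * R * R => z.1.1).
  exact: measurableT_comp measurable_fst measurable_fst.
have m2 : measurable_fun setT (fun z : R * R * R => z.1.2).
  exact: measurableT_comp measurable_snd measurable_fst.
have m3 : measurable_fun setT (fun z : R * R * R => z.2) by exact: measurable_snd.
rewrite /kern; apply: measurable_fun_ifT.
- apply: measurable_or; apply: measurable_and.
  + exact: measurable_fun_ltr.
  + exact: measurable_fun_ler.
  + exact: measurable_fun_ltr.
  + exact: measurable_fun_ler.
- apply: measurable_funM.
    apply: (measurableT_comp measurable_inv).
    exact: (measurableT_comp (@normr_measurable R setT)).
  apply: (measurableT_comp (@measurable_expR R)).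
  apply: measurable_funM; first exact: measurable_funB.
  exact: (measurableT_comp measurable_inv).
- exact: measurable_cst.
Qed.

Lemma measurable_kern1 x mu : measurable_fun setT (kern x mu).
Proof.
exact: (measurableT_comp measurable_kern (pair1_measurable (x, mu))).
Qed.

Lemma measurable_half_line : measurable (@half_line R).
Proof. exact: measurable_itv. Qed.

Lemma is_derive_expR_aff x mu (c s : R) : mu != 0 ->
  is_derive s 1 (fun s => c * (mu * expR ((s - x) / mu))) (c * expR ((s - x) / mu)).
Proof.
move=> mu0; apply: is_derive_eq.
by rewrite /GRing.scale/= subr0 mulr1; field.
Qed.

Lemma continuous_expR_aff x mu : continuous (fun s : R => expR ((s - x) / mu)).
Proof.
move=> s; apply: continuous_comp; last exact: continuous_expR.
apply: cvgM; last exact: cvg_cst.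
apply: cvgB; [exact: cvg_id|exact: cvg_cst].
Qed.

(** The mass missing from 1 when mu > 0 is the weight e^{-x/mu} that the boundary value receives in
    [rad] and [step]. Both are thus averages of boundary value and source, which is the maximum
    principle behind all bounds by C. *)
Lemma integral_kern x mu : 0 <= x -> mu != 0 ->
  (\int[leb]_(s in half_line) (kern x mu s)%:E =
    (1 - (0 < mu)%R%:R * expR (- (x / mu)))%:E)%E.
Proof.
move=> x0 mu0.
have F's s : is_derive s 1 (fun s => mu^-1 * (mu * expR ((s - x) / mu)))
    (mu^-1 * expR ((s - x) / mu)) by exact: is_derive_expR_aff.
have Fn s : is_derive s 1 (fun s => - (mu^-1 * (mu * expR ((s - x) / mu))))
    (- (mu^-1 * expR ((s - x) / mu))).
  by have h := F's s; apply: is_deriveN.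
have cF : continuous (fun s => mu^-1 * (mu * expR ((s - x) / mu))).
  move=> s; apply: cvgM; [exact: cvg_cst|apply: cvgM; [exact: cvg_cst|]].
  exact: continuous_expR_aff.
have cf : continuous (fun s => mu^-1 * expR ((s - x) / mu)).
  move=> s; apply: cvgM; [exact: cvg_cst|exact: continuous_expR_aff].
have [mup|mun|muE] := ltgtP 0 mu; last by rewrite muE eqxx in mu0.
- transitivity (\int[leb]_(s in `[0%R, x]) (mu^-1 * expR ((s - x) / mu))%:E)%E.
    rewrite integral_mkcond [RHS]integral_mkcond; apply: eq_integral => s _.
    rewrite !patchE /half_line !mem_setE !in_itv/= andbT /kern mup (lt_gtF mup)/= orbF.
    by case: (0 <= s) => //=; case: (s <= x) => //; rewrite gtr0_norm.
  move: x0; rewrite le_eqVlt => /predU1P[<-|x0].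
    by rewrite set_itv1 integral_set1 mul0r oppr0 expR0 mul1r subrr.
  rewrite (@continuous_FTC2 _ _ (fun s => mu^-1 * (mu * expR ((s - x) / mu))))//.
  + rewrite subrr mul0r expR0 sub0r mulNr -EFinB.
    by congr EFin; rewrite mul1r; field.
  + exact: continuous_subspaceT.
  + split.
    * by move=> s _; have [] := F's s.
    * exact/cvg_at_right_filter/cF.
    * exact/cvg_at_left_filter/cF.
  + by move=> s _; rewrite derive1E; exact: (@derive_val _ _ _ _ _ _ _ (F's s)).
- transitivity (\int[leb]_(s in `[x, +oo[) (- (mu^-1 * expR ((s - x) / mu)))%:E)%E.
    rewrite integral_mkcond [RHS]integral_mkcond; apply: eq_integral => s _.
    rewrite !patchE /half_line !mem_setE !in_itv/= !andbT /kern mun (lt_gtF mun)/=.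
    have [xs|xs] := leP x s; last by case: ifP.
    by rewrite (le_trans x0 xs) ltr0_norm// invrN mulNr.
  rewrite (@ge0_continuous_FTC2y _ _ (fun s => - (mu^-1 * (mu * expR ((s - x) / mu)))) _ 0)//.
  + rewrite subrr mul0r expR0 mul0r subr0 -EFinB.
    by congr EFin; field.
  + move=> s xs; rewrite -mulNr mulr_ge0 ?expR_ge0//.
    by rewrite oppr_ge0 invr_le0 ltW.
  + apply: continuous_subspaceT => s; apply: cvgN; exact: cf.
  + rewrite -[X in _ --> X]oppr0; apply: cvgN.
    rewrite (_ : (fun s => _) = (fun s => expR ((s - x) / mu))); last first.
      by apply/funext => s; field.
    rewrite (_ : (fun s => _) = (fun y => expR (- y)) \o (fun s => (s - x) / - mu)).
      apply: cvg_comp; last exact: cvgr_expR.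
      apply/cvgryPge => A; near=> s.
      rewrite ler_pdivlMr ?oppr_gt0// lerBrDr.
      by near: s; apply: nbhs_pinfty_ge; exact: num_real.
    by apply/funext => s /=; rewrite invrN mulrN opprK.
  + by apply/cvg_at_right_filter; apply: cvgN; exact: cF.
  + by move=> s _; rewrite derive1E; exact: (@derive_val _ _ _ _ _ _ _ (Fn s)).
Unshelve. all: end_near. Qed.

End sweep.

Section sweep_theory.
Context {R : realType}.
Implicit Types (f g : R -> R) (x mu s C : R).
Notation leb := (@lebesgue_measure R).

Lemma clip_ge0 x : 0 <= Num.max x 0.
Proof. by rewrite le_max lexx orbT. Qed.

Lemma clipE x : 0 <= x -> Num.max x 0 = x.
Proof. by move=> x0; apply/max_idPl. Qed.

Lemma integrable_kern x mu : 0 <= x -> mu != 0 ->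
  leb.-integrable half_line (EFin \o kern x mu).
Proof.
move=> x0 mu0; apply/integrableP; split.
  by apply/measurable_EFinP; apply: measurable_funTS; exact: measurable_kern1.
under eq_integral do rewrite /= ger0_norm ?kern_ge0//.
by rewrite integral_kern// ltry.
Qed.

Lemma integrable_kernM f C x mu : bmf C f -> 0 <= x -> mu != 0 ->
  leb.-integrable half_line (EFin \o (fun s => kern x mu s * f s)).
Proof.
move=> [mf fC] x0 mu0.
have h := integrable_kern x0 mu0.
apply: (@eq_integrable _ _ _ leb _ (measurable_half_line (R := R))
   (fun s => (kern x mu s)%:E * (f s)%:E)%E) => //.
apply: (integrableMl _ h) => //.
- exact: measurable_half_line.
- exact: measurable_funTS.
- exists C; split; first exact: num_real.
  move=> y Cy s _; have /andP[f0 fs] := fC s.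
  by rewrite /= ger0_norm// (le_trans fs)// ltW.
Qed.

Lemma Rintegral_kern x mu : 0 <= x -> mu != 0 ->
  \int[leb]_(s in half_line) (kern x mu s) =
    1 - (0 < mu)%R%:R * expR (- (x / mu)).
Proof. by move=> x0 mu0; rewrite /Rintegral integral_kern. Qed.

Lemma sweep_ge0 f x mu : (forall s, 0 <= s -> 0 <= f s) -> 0 <= sweep f x mu.
Proof.
move=> f0; apply: Rintegral_ge0 => s; rewrite /half_line/= in_itv/= andbT => s0.
by rewrite mulr_ge0 ?kern_ge0// f0.
Qed.

Lemma sweep_ler f g C x mu : bmf C f -> bmf C g -> mu != 0 ->
  (forall s, 0 <= s -> f s <= g s) -> sweep f x mu <= sweep g x mu.
Proof.
move=> bf bg mu0 fg; apply: le_Rintegral.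
- exact: measurable_half_line.
- exact: integrable_kernM bf (clip_ge0 x) mu0.
- exact: integrable_kernM bg (clip_ge0 x) mu0.
- move=> s; rewrite /half_line/= in_itv/= andbT => s0.
  by rewrite ler_wpM2l ?kern_ge0// fg.
Qed.

Lemma sweep_cst C x mu : mu != 0 ->
  sweep (cst C) x mu = C * (1 - (0 < mu)%R%:R * expR (- (Num.max x 0 / mu))).
Proof.
move=> mu0; rewrite /sweep RintegralZr; last 2 first.
- exact: measurable_half_line.
- exact: integrable_kern (clip_ge0 x) mu0.
by rewrite Rintegral_kern ?clip_ge0// mulrC.
Qed.

Lemma bmf_cst C : 0 <= C -> bmf C (cst C).
Proof. by move=> C0; split=> // x; rewrite C0 lexx. Qed.

Lemma bmf_ge0 f C : bmf C f -> 0 <= C.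
Proof. by move=> [_ /(_ 0)/andP[]]; exact: le_trans. Qed.

Lemma sweep_le f C x mu : bmf C f -> mu != 0 ->
  sweep f x mu <= C * (1 - (0 < mu)%R%:R * expR (- (Num.max x 0 / mu))).
Proof.
move=> bf mu0; rewrite -sweep_cst//.
apply: (@sweep_ler _ _ C) => //; first exact: bmf_cst (bmf_ge0 bf).
by move=> s _; case: bf => _ /(_ s)/andP[].
Qed.

Lemma sweep_leC f C x mu : bmf C f -> mu != 0 -> sweep f x mu <= C.
Proof.
move=> bf mu0; apply: le_trans (sweep_le x bf mu0) _.
rewrite -[leRHS]mulr1; apply: ler_wpM2l; first exact: bmf_ge0 bf.
by rewrite gerBl mulr_ge0 ?expR_ge0.
Qed.

Lemma sweep_cvg (f_ : nat -> R -> R) f C x mu : (forall n, bmf C (f_ n)) ->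
  bmf C f -> mu != 0 ->
  (forall s, 0 <= s -> f_ n s @[n --> \oo] --> f s) ->
  sweep (f_ n) x mu @[n --> \oo] --> sweep f x mu.
Proof.
move=> bf_ bf mu0 ff.
have mH := measurable_half_line (R := R).
have int g : bmf C g -> leb.-integrable half_line
    (EFin \o (fun s => kern (Num.max x 0) mu s * g s)).
  by move=> bg; exact: integrable_kernM bg (clip_ge0 x) mu0.
apply: fine_cvg; rewrite fineK; last exact/integrable_fin_num/int.
apply: (@dominated_cvg _ _ _ leb _ _
  (fun n s => (kern (Num.max x 0) mu s * f_ n s)%:E) _
  (EFin \o (fun s => kern (Num.max x 0) mu s * C))) => //.
- by move=> n; have /integrableP[] := int _ (bf_ n).
- move=> s; rewrite /half_line/= in_itv/= andbT => s0.
  apply: cvg_EFin; first exact: nearW.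
  by apply: cvgM; [exact: cvg_cst|exact: ff].
- exact: int (bmf_cst (bmf_ge0 bf)).
- move=> n s _; have [_ /(_ s)/andP[f0 fC]] := bf_ n.
  by rewrite lee_fin ger0_norm ?mulr_ge0 ?kern_ge0// ler_wpM2l ?kern_ge0.
Qed.

Lemma measurable_clip : measurable_fun setT (fun x : R => Num.max x 0).
Proof. by apply: continuous_measurable_fun; exact: continuous_clip. Qed.

Lemma measurable_Rintegral2 (D : set R) d (X : measurableType d) (F : X * R -> R) :
  measurable D -> measurable_fun setT F -> (forall z, D z.2 -> 0 <= F z) ->
  measurable_fun setT (fun z => \int[leb]_(s in D) F (z, s)).
Proof.
move=> mD mF F0.
(* Tonelli's theorem is applied to a function that is nonnegative on the whole product, while [F] is
   known to be so only over [D]. *)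
pose G (z : X * R) := (F z * \1_D z.2)%:E.
have mG : measurable_fun setT G.
  apply/measurable_EFinP; apply: measurable_funM => //.
  by apply: (measurableT_comp (measurable_indic _)).
have G0 z : (0 <= G z)%E.
  rewrite lee_fin indicE; case: (boolP (z.2 \in D)) => [|_]; last by rewrite mulr0.
  by rewrite inE => /F0; rewrite mulr1.
have := measurable_fun_fubini_tonelli_F (m2 := leb) G mG G0.
move=> h; rewrite [X in measurable_fun _ X](_ : _ = fine \o (fubini_F leb G)).
  by apply: measurableT_comp h; exact: fine_measurable.
apply/funext => z; rewrite /= /Rintegral /fubini_F integral_mkcond; congr fine.
apply: eq_integral => s _; rewrite patchE /G/= indicE.
by case: ifP => _; rewrite ?mulr1 ?mulr0.
Qed.

Lemma measurable_sweep f : measurable_fun setT f ->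
  (forall s, 0 <= s -> 0 <= f s) ->
  measurable_fun setT (fun z : R * R => sweep f z.1 z.2).
Proof.
move=> mf f0; apply: (@measurable_Rintegral2 _ _ _
  (fun w : (R * R) * R => kern (Num.max w.1.1 0) w.1.2 w.2 * f w.2)).
- exact: measurable_half_line.
- apply: measurable_funM; last exact: measurableT_comp.
  apply: (@measurableT_comp _ _ _ _ _ _ _ _
   (fun w : (R * R) * R => ((Num.max w.1.1 0, w.1.2), w.2)) measurable_kern).
  apply: measurable_fun_pair => //; apply: measurable_fun_pair.
    by apply: (measurableT_comp measurable_clip); exact: measurableT_comp measurable_fst.
  exact: measurableT_comp measurable_snd measurable_fst.
- move=> [z s]; rewrite /half_line/= in_itv/= andbT => s0.
  by rewrite mulr_ge0 ?kern_ge0 ?f0.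
Qed.

Lemma measurable_sweep1 f mu : measurable_fun setT f ->
  (forall s, 0 <= s -> 0 <= f s) -> measurable_fun setT (sweep f ^~ mu).
Proof.
move=> mf f0.
exact: (measurableT_comp (measurable_sweep mf f0) (pair2_measurable mu)).
Qed.

Lemma bmf_sweep f C mu : bmf C f -> mu != 0 -> bmf C (sweep f ^~ mu).
Proof.
move=> bf mu0; have f0 s : 0 <= f s by case: bf => _ /(_ s)/andP[].
split; first by apply: measurable_sweep1 => //; case: bf.
by move=> x; rewrite sweep_ge0//= (sweep_leC _ bf).
Qed.

End sweep_theory.

Section sweep_calculus.
Context {R : realType}.
Implicit Types (f g : R -> R) (x mu s C : R).
Notation leb := (@lebesgue_measure R).

Lemma integrable_exp_weight f C mu (a b : R) : bmf C f ->
  leb.-integrable `[a, b] (EFin \o (fun s => expR (s / mu) * f s)).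
Proof.
move=> [mf fC].
apply: (@bounded_integrable _ _ _ leb _ _ (expR ((`|a| + `|b|) / `|mu|) * C)).
- exact: measurable_itv.
- by rewrite /= lebesgue_measure_itv; case: ifP => _; rewrite -?EFinB ltry.
- apply: measurable_funTS; apply: measurable_funM => //.
  apply: (measurableT_comp (@measurable_expR R)).
  exact: measurable_funM.
- move=> s; rewrite /= in_itv/= => /andP[as_ sb].
  have /andP[f0 fs] := fC s.
  rewrite ger0_norm ?mulr_ge0 ?expR_ge0//; apply: ler_pM => //.
  rewrite ler_expR (le_trans (ler_norm _))// normrM normfV.
  rewrite ler_wpM2r ?invr_ge0//.
  have := ler_norm b; have := ler_norm (- a); rewrite normrN => h1 h2.
  rewrite ler_norml; apply/andP; split.
    by have := normr_ge0 b; lra.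
  by have := normr_ge0 a; lra.
Qed.

Lemma continuous_primitive_clip f C mu : bmf C f ->
  continuous (fun x => \int[leb]_(s in `[0%R, Num.max x 0]) (expR (s / mu) * f s)).
Proof.
move=> bf a.
(* Extending the integrand by 0 to s < 0 and integrating from some L < min(a, 0) gives the same
   function. The point [a], be it 0 or negative, is now interior, and the continuity of an ordinary
   primitive applies. *)
pose g s := (fun s => expR (s / mu) * f s) s * \1_(`[0%R, +oo[%classic) s.
pose L := Num.min a 0 - 1.
have La : L < a by rewrite /L ltrBlDr (@le_lt_trans _ _ a)// ?ge_min ?lexx// ltrDl.
have L0 : L < 0 by rewrite /L ltrBlDr (@le_lt_trans _ _ 0)// ?ge_min ?lexx ?orbT// ltrDl.
have gE : g = (fun s => expR (s / mu) * f s) \_ `[0%R, +oo[.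
  by apply/funext => s; rewrite patchE /g indicE; case: ifP => _; rewrite ?mulr1 ?mulr0.
have intg : leb.-integrable `[L, a + 1] (EFin \o g).
  rewrite gE -restrict_EFin; apply: (integrable_restrict leb _ _ _).1 => //.
  have := integrable_exp_weight mu L (a + 1) bf.
  by apply: integrableS => //; exact: measurableI.
have La1 : L <= a + 1 by rewrite (le_trans (ltW La))// lerDl.
have La1' : L < a + 1 by rewrite (lt_trans La)// ltrDl.
have := parameterized_integral_continuous La1 intg.
move=> /(continuous_within_itvP _ La1')[+ _ _].
have aI : a \in `]L, a + 1[ by rewrite in_itv/= La ltrDl ltr01.
move=> /(_ a aI).
rewrite /continuous_at.
have JE x : L <= x -> \int[leb]_(s in `[L, x]) g s =
    \int[leb]_(s in `[0%R, Num.max x 0]) (expR (s / mu) * f s).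
  move=> Lx; rewrite gE -Rintegral_mkcondr.
  have [x0|x0] := leP 0 x.
    congr (Rintegral _ _ _); apply/seteqP; split => s /=.
      by rewrite !in_itv/= andbT => -[/andP[_ ->] ->].
    by rewrite !in_itv/= andbT => /andP[s0 ->]; rewrite s0 (le_trans (ltW L0) s0).
  rewrite set_itv1 Rintegral_set1 (_ : _ `&` _ = set0) ?Rintegral_set0//.
  rewrite -subset0 => s [] /=; rewrite !in_itv/= andbT => /andP[_ sx] s0.
  by have := le_lt_trans (le_trans s0 sx) x0; rewrite ltxx.
rewrite {2}/parameterized_integral JE ?(ltW La)//; apply: cvg_trans; apply: near_eq_cvg.
near=> x; rewrite /parameterized_integral JE//; near: x; exact: lt_le_nbhsr.
Unshelve. all: end_near. Qed.

(** Pulling e^{-x/mu} out of the kernel leaves an integral of e^{s/mu} f(s). For mu > 0 it runs over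
    [0, x] and c = 0; for mu < 0 it runs over [x, +oo[ and equals the total minus the primitive, the
    total going into c. One formula then serves both signs. *)
Lemma sweep_formula f C mu : bmf C f -> mu != 0 ->
  exists c : R, forall x,
    sweep f x mu = mu^-1 * expR (- mu^-1 * Num.max x 0) *
      (c + \int[leb]_(s in `[0%R, Num.max x 0]) (expR (s / mu) * f s)).
Proof.
move=> bf mu0.
pose e s := expR (s / mu) * f s.
have mH := measurable_half_line (R := R).
have kE x s : expR ((s - x) / mu) * f s = expR (- mu^-1 * x) * e s.
  rewrite /e mulrA -expRD; congr (expR _ * _); by field.
have [mup|mun|muE] := ltgtP 0 mu; last by rewrite muE eqxx in mu0.
- exists 0 => x; rewrite add0r -RintegralZl; last 2 first.
  + exact: measurable_itv.
  + exact: integrable_exp_weight bf.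
  rewrite /sweep Rintegral_mkcond [RHS]Rintegral_mkcond; apply: eq_Rintegral => s _.
  rewrite !patchE /half_line !mem_setE !in_itv/= andbT /kern mup (lt_gtF mup)/= orbF.
  case: (0 <= s) => //=; case: (s <= _) => //; last by rewrite mul0r.
  by rewrite gtr0_norm// -mulrA kE mulrA.
(* For mu < 0 the kernel at x = 0 is e^{s/mu} / |mu| on the whole half-line, so integrability is
   read off from it after multiplication by -mu. *)
- have inte : leb.-integrable half_line (EFin \o e).
    have := @integrableZl _ _ _ leb _ mH (- mu) _ (integrable_kernM bf (lexx 0) mu0).
    apply: eq_integrable => // s; rewrite inE /half_line/= in_itv/= andbT => s0.
    rewrite -EFinM /kern mun s0 (lt_gtF mun)/= ltr0_norm// -mulrA kE mulr0 expR0 mul1r.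
    by congr EFin; rewrite /e; field.
  exists (- \int[leb]_(s in half_line) e s) => x; set y := Num.max x 0.
  have y0 : 0 <= y by exact: clip_ge0.
  rewrite addrC -opprB mulrN -mulNr /half_line (@Rintegral_itvB _ e (BLeft 0) +oo%O y)//.
  rewrite Rintegral_itv_obnd_cbnd; last first.
    apply: integrableS inte => //.
    by move=> s; rewrite /half_line /= !in_itv/= !andbT => /ltW; exact: le_trans.
  have sub : `[y, +oo[%classic `<=` half_line.
    by move=> s; rewrite /half_line /= !in_itv/= !andbT; exact: le_trans.
  rewrite -RintegralZl//; last first.
    by apply: integrableS inte => //; exact: measurable_itv.
  rewrite /sweep Rintegral_mkcond [RHS]Rintegral_mkcond; apply: eq_Rintegral => s _.
  rewrite !patchE /half_line !mem_setE !in_itv/= !andbT /kern mun (lt_gtF mun)/=.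
  rewrite -/y; have [ys|ys] := leP y s; last by rewrite mul0r; case: ifP.
  by rewrite (le_trans y0 ys) ltr0_norm// -mulrA kE invrN !mulNr mulrA.
Qed.

Lemma continuous_sweep f C mu : bmf C f -> mu != 0 -> continuous (sweep f ^~ mu).
Proof.
move=> bf mu0; have [c sE] := sweep_formula bf mu0.
have -> : sweep f ^~ mu = fun x => mu^-1 * expR (- mu^-1 * Num.max x 0) *
      (c + \int[leb]_(s in `[0%R, Num.max x 0]) (expR (s / mu) * f s)).
  by apply/funext => x; rewrite sE.
move=> x; apply: cvgM.
  apply: cvgM; first exact: cvg_cst.
  apply: (@continuous_comp _ _ _ (fun x => Num.max x 0) (fun x => expR (- mu^-1 * x))).
    exact: continuous_clip.
  by have [+ _ _] := half_C1_expR (- mu^-1); exact.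
by apply: cvgD; [exact: cvg_cst|exact: (continuous_primitive_clip bf)].
Qed.

Lemma half_C1_sweep f C mu : bmf C f -> mu != 0 -> continuous f ->
  half_C1 (sweep f ^~ mu) (fun x => (f x - sweep f x mu) / mu).
Proof.
move=> bf mu0 cf; have cs := continuous_sweep bf mu0.
split => //.
  move=> x; apply: cvgM; last exact: cvg_cst.
  by apply: cvgB; [exact: cf|exact: cs].
move=> x x0; have [c sE] := sweep_formula bf mu0.
pose e s := expR (s / mu) * f s.
have ce : continuous e.
  move=> s; apply: cvgM; last exact: cf.
  apply: (@continuous_comp _ _ _ (fun x => x / mu) expR); last exact: continuous_expR.
  exact: mulrr_continuous.
have xx1 : x < x + 1 by rewrite ltrDl.
have [dI IE] := continuous_FTC1_closed xx1 (integrable_exp_weight mu 0 (x + 1) bf) x0 (ce x).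
have h1 : is_derive x 1 (fun y => \int[leb]_(s in `[0%R, y]) e s) (e x).
  by apply: DeriveDef => //; rewrite -derive1E.
have [_ _ /(_ x x0) h2] := half_C1Z (mu^-1) (half_C1_expR (- mu^-1)).
have h3 : is_derive x 1 (fun y => c + \int[leb]_(s in `[0%R, y]) e s) (0 + e x).
  by apply: is_deriveD.
apply: (@near_eq_is_derive _ _ _ (fun x => mu^-1 * expR (- mu^-1 * x) *
      (c + \int[leb]_(s in `[0%R, x]) e s))).
  near=> y; rewrite /= sE clipE//; near: y; exact: lt_le_nbhsr.
have -> : (f x - sweep f x mu) / mu = (mu^-1 * expR (- mu^-1 * x)) *: (0 + e x) +
   (c + \int[leb]_(s in `[0%R, x]) e s) *: (mu^-1 * (- mu^-1 * expR (- mu^-1 * x))).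
  rewrite sE clipE ?(ltW x0)// -/e /GRing.scale/= add0r.
  have -> : f x = expR (- mu^-1 * x) * e x.
    by rewrite /e mulrA -expRD mulNr [mu^-1 * x]mulrC addNr expR0 mul1r.
  rewrite -/e; ring.
exact: is_deriveM.
Unshelve. all: end_near. Qed.

End sweep_calculus.

(** * Existence by monotone iteration *)

Section quartic.
Context {R : realFieldType}.

Lemma quartic_ge (a b C : R) : 0 <= a -> a <= b -> b <= C ->
  b ^+ 4 - a ^+ 4 <= 4 * C ^+ 3 * (b - a).
Proof.
move=> a0 ab bC; have b0 := le_trans a0 ab; have C0 := le_trans b0 bC.
have -> : b ^+ 4 - a ^+ 4 = (b ^+ 3 + b ^+ 2 * a + b * a ^+ 2 + a ^+ 3) * (b - a).
  by ring.
apply: ler_wpM2r; first by rewrite subr_ge0.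
have aC := le_trans ab bC.
have h1 : b ^+ 3 <= C ^+ 3 by rewrite lerXn2r// nnegrE.
have h4 : a ^+ 3 <= C ^+ 3 by rewrite lerXn2r// nnegrE.
have h2 : b ^+ 2 * a <= C ^+ 3.
  rewrite [leRHS]exprSr; apply: ler_pM => //; first exact: exprn_ge0.
  by rewrite lerXn2r// nnegrE.
have h3 : b * a ^+ 2 <= C ^+ 3.
  rewrite [leRHS]exprS; apply: ler_pM => //; first exact: exprn_ge0.
  by rewrite lerXn2r// nnegrE.
lra.
Qed.

Lemma quartic_dist (a b C : R) : 0 <= a <= C -> 0 <= b <= C ->
  `|b ^+ 4 - a ^+ 4| <= 4 * C ^+ 3 * `|b - a|.
Proof.
move=> /andP[a0 aC] /andP[b0 bC].
have [ab|/ltW ba] := leP a b.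
  rewrite !ger0_norm ?subr_ge0//; first exact: quartic_ge.
  by rewrite lerXn2r// nnegrE.
rewrite distrC [`|b - a|]distrC !ger0_norm ?subr_ge0//; first exact: quartic_ge.
by rewrite lerXn2r// nnegrE.
Qed.

End quartic.

Section bmf_closure.
Context {R : realType}.

Lemma bmfX4 (C : R) (T : R -> R) : bmf C T -> bmf (C ^+ 4) (fun s => T s ^+ 4).
Proof.
move=> [mT TC]; split; first exact: measurable_funX.
move=> x; have /andP[T0 TCx] := TC x; have C0 := le_trans T0 TCx.
by rewrite exprn_ge0//= lerXn2r// nnegrE.
Qed.

Lemma bmf_nonneg (f : R -> R) (B : R) : bmf B f -> forall s, 0 <= f s.
Proof. by move=> [_ h] s; have /andP[] := h s. Qed.

End bmf_closure.

Section radiation.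
Context {R : realType}.
Implicit Types (f g T S : R -> R) (x mu s : R).
Notation leb := (@lebesgue_measure R).
(* D is [-1, 1] deprived of mu = 0 and of the null set of those mu at which the
   incoming intensity pb exceeds its essential bound. *)
Variables (Tb C kappa : R) (pb : R -> R) (D : set R).
Hypothesis Tb_ge0 : 0 <= Tb.
Hypothesis TbC : Tb <= C.
Hypothesis kappa_gt0 : 0 < kappa.
Hypothesis kappa_large : 8 * C ^+ 3 <= kappa ^+ 2.
Hypothesis mpb : measurable_fun setT pb.
Hypothesis pb_ge0 : forall mu, 0 <= pb mu.
Hypothesis pb_neg : forall mu, mu <= 0 -> pb mu = 0.
Hypothesis mD : measurable D.
Hypothesis D_directions : D `<=` directions.
Hypothesis D_neq0 : forall mu, D mu -> mu != 0.
Hypothesis D_le : forall mu, D mu -> pb mu <= C ^+ 4.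

Let C_ge0 : 0 <= C. Proof. exact: le_trans TbC. Qed.

Definition rad S x mu := pb mu * expR (- (Num.max x 0 / mu)) + sweep S x mu.
Definition absb S x := \int[leb]_(mu in D) rad S x mu.
(** The mass of [D] is not evaluated: in this form it matches the bound of [absb_le] for the
    constant temperature C, and the integral of a constant over [D] in the equation for T''.
    Monotonicity uses that it lies between 0 and 2. *)
Definition source T x :=
  T x + (kappa ^+ 2)^-1 * (absb (fun s => T s ^+ 4) x - fine (leb D) * T x ^+ 4).
(** The transport kernel is reused for the two factors of the heat operator: the inner sweep, with
    mu = -1/kappa, is the bounded solution of w - w'/kappa = q; the outer one, with mu = 1/kappa,
    solves T + T'/kappa = w from the value [Tb] at 0. *)
Definition step T x := Tb * expR (- kappa * Num.max x 0) +
  sweep (sweep (source T) ^~ (- kappa^-1)) x kappa^-1.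

Lemma leb_directions : leb (@directions R) = 2%:E.
Proof.
rewrite /directions lebesgue_measure_itv/= lte_fin ifT; last by lra.
by rewrite -EFinB; congr EFin; lra.
Qed.

Lemma leb_D_le2 : (leb D <= 2%:E)%E.
Proof.
rewrite -leb_directions; apply: le_measure; rewrite ?inE//.
exact: measurable_itv.
Qed.

Lemma leb_D_fin : (leb D < +oo)%E.
Proof. by apply: le_lt_trans leb_D_le2 _; rewrite ltry. Qed.

Lemma mass_bounds : 0 <= fine (leb D) <= 2.
Proof.
rewrite fine_ge0//= -lee_fin fineK ?leb_D_le2//.
by rewrite ge0_fin_numE// leb_D_fin.
Qed.

Lemma rad_ge0 S x mu : (forall s, 0 <= S s) -> 0 <= rad S x mu.
Proof.
by move=> S0; rewrite addr_ge0 ?sweep_ge0// mulr_ge0 ?expR_ge0.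
Qed.

Lemma rad_le S x mu : bmf (C ^+ 4) S -> D mu -> rad S x mu <= C ^+ 4.
Proof.
move=> bS Dmu; rewrite /rad.
have := sweep_le x bS (D_neq0 Dmu).
have [mup|mun] := ltP 0 mu; last first.
  by rewrite /= pb_neg// !mul0r add0r subr0 mulr1.
rewrite mul1r; set e := expR _ => h.
have := D_le Dmu; have : 0 <= e by exact: expR_ge0.
by move=> e0 /(ler_wpM2r e0); lra.
Qed.

Lemma measurable_rad S : measurable_fun setT S -> (forall s, 0 <= S s) ->
  measurable_fun setT (fun z : R * R => rad S z.1 z.2).
Proof.
move=> mS S0; apply: measurable_funD; last exact: measurable_sweep.
apply: measurable_funM; first exact: (measurableT_comp mpb measurable_snd).
apply: (measurableT_comp (@measurable_expR R)).
apply: (@measurableT_comp _ _ _ _ _ _ (@GRing.opp R)); first exact: oppr_measurable.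
apply: measurable_funM.
  exact: (measurableT_comp measurable_clip measurable_fst).
exact: (measurableT_comp measurable_inv measurable_snd).
Qed.

Lemma measurable_rad1 S x : measurable_fun setT S -> (forall s, 0 <= S s) ->
  measurable_fun setT (rad S x).
Proof.
move=> mS S0; exact: (measurableT_comp (measurable_rad mS S0) (pair1_measurable x)).
Qed.

Lemma integrable_rad S x : bmf (C ^+ 4) S -> leb.-integrable D (EFin \o rad S x).
Proof.
move=> bS; have S0 := bmf_nonneg bS.
apply: (@bounded_integrable _ _ _ leb _ _ (C ^+ 4)) => //.
- exact: leb_D_fin.
- by apply: measurable_funTS; apply: measurable_rad1 => //; case: bS.
- by move=> mu Dmu; rewrite ger0_norm ?rad_ge0// rad_le.
Qed.

Lemma absb_ge0 S x : (forall s, 0 <= S s) -> 0 <= absb S x.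
Proof. by move=> S0; apply: Rintegral_ge0 => mu _; exact: rad_ge0. Qed.

Lemma absb_le S x : bmf (C ^+ 4) S -> absb S x <= C ^+ 4 * fine (leb D).
Proof.
move=> bS; rewrite -Rintegral_cst//; apply: le_Rintegral => //.
- exact: integrable_rad.
- apply: (@bounded_integrable _ _ _ leb _ _ (C ^+ 4)) => //; first exact: leb_D_fin.
  by move=> mu _; rewrite ger0_norm// exprn_ge0.
- by move=> mu Dmu; exact: rad_le.
Qed.

Lemma absb_ler S S' x : bmf (C ^+ 4) S -> bmf (C ^+ 4) S' ->
  (forall s, S s <= S' s) -> absb S x <= absb S' x.
Proof.
move=> bS bS' SS'; apply: le_Rintegral => //; try exact: integrable_rad.
move=> mu Dmu; rewrite lerD2l; apply: (sweep_ler x bS bS' (D_neq0 Dmu)) => s _.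
exact: SS'.
Qed.

Lemma measurable_absb S : measurable_fun setT S -> (forall s, 0 <= S s) ->
  measurable_fun setT (absb S).
Proof.
move=> mS S0; apply: (@measurable_Rintegral2 _ _ _ _ (fun z : R * R => rad S z.1 z.2)) => //.
  exact: measurable_rad.
by move=> z _; exact: rad_ge0.
Qed.

Lemma cvg_Rintegral_bounded (g_ : nat -> R -> R) (g : R -> R) (B : R) :
  (forall n, measurable_fun D (g_ n)) -> measurable_fun D g ->
  (forall n mu, D mu -> `|g_ n mu| <= B) -> (forall mu, D mu -> `|g mu| <= B) ->
  (forall mu, D mu -> g_ n mu @[n --> \oo] --> g mu) ->
  \int[leb]_(mu in D) g_ n mu @[n --> \oo] --> \int[leb]_(mu in D) g mu.
Proof.
move=> mg_ mg g_B gB gg.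
have int (h : R -> R) : measurable_fun D h -> (forall mu, D mu -> `|h mu| <= B) ->
    leb.-integrable D (EFin \o h).
  by move=> mh hB; apply: (@bounded_integrable _ _ _ leb _ _ B) => //; exact: leb_D_fin.
apply: fine_cvg; rewrite fineK; last exact/integrable_fin_num/int.
apply: (@dominated_cvg _ _ _ leb _ _ (fun n s => (g_ n s)%:E) _ (EFin \o (cst `|B|))) => //.
- by move=> n; apply/measurable_EFinP; exact: mg_.
- by move=> mu Dmu; apply: cvg_EFin; [exact: nearW|exact: gg].
- apply: (@bounded_integrable _ _ _ leb _ _ `|B|) => //; first exact: leb_D_fin.
  by move=> mu _; rewrite normr_id.
- by move=> n mu Dmu; rewrite lee_fin (le_trans (g_B n mu Dmu))// ler_norm.
Qed.

(** Absorption increases with T; the emission term has the wrong sign, but its increment is at most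
    2 * 4 C^3 (T' - T) / kappa^2, which the linear term T' - T dominates. This is where the 8 of
    [kappa_large] comes from. *)
Lemma source_ler T T' x : bmf C T -> bmf C T' -> (forall s, T s <= T' s) ->
  source T x <= source T' x.
Proof.
move=> bT bT' TT'; rewrite /source.
have h1 : absb (fun s => T s ^+ 4) x <= absb (fun s => T' s ^+ 4) x.
  apply: absb_ler; [exact: bmfX4|exact: bmfX4|move=> s].
  by rewrite lerXn2r ?nnegrE ?(bmf_nonneg bT)// (bmf_nonneg bT').
have /andP[T0 _] := bT.2 x; have /andP[T0' TC'] := bT'.2 x.
have h2 := quartic_ge T0 (TT' x) TC'.
have /andP[m0 m2] := mass_bounds.
set m := fine _ in m0 m2 *.
set L := (_ ^+ 2)^-1.
have L0 : 0 <= L by rewrite invr_ge0 exprn_ge0// ltW.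
have L1 : L * (8 * C ^+ 3) <= 1.
  by rewrite mulrC ler_pdivrMr ?mul1r// exprn_gt0.
have h3 : L * (m * (T' x ^+ 4 - T x ^+ 4)) <= T' x - T x.
  have C3 : 0 <= 4 * C ^+ 3 * (T' x - T x).
    by rewrite mulr_ge0 ?mulr_ge0 ?exprn_ge0// subr_ge0.
  have h4 : m * (T' x ^+ 4 - T x ^+ 4) <= 2 * (4 * C ^+ 3 * (T' x - T x)).
    apply: le_trans (ler_wpM2l m0 h2) _; exact: ler_wpM2r.
  apply: le_trans (ler_wpM2l L0 h4) _.
  have -> : L * (2 * (4 * C ^+ 3 * (T' x - T x))) = L * (8 * C ^+ 3) * (T' x - T x) by ring.
  by rewrite -[leRHS]mul1r ler_wpM2r// subr_ge0.
have := ler_wpM2l L0 h1.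
lra.
Qed.

Lemma source_cst_le x : source (cst C) x <= C.
Proof.
rewrite /source -[leRHS]addr0 lerD2l pmulr_rle0; last first.
  by rewrite invr_gt0 exprn_gt0.
rewrite subr_le0 mulrC; apply: absb_le.
by apply: (@bmfX4 _ _ (cst C)); exact: bmf_cst.
Qed.

Lemma source0_ge0 x : 0 <= source (cst 0) x.
Proof.
rewrite /source /cst expr0n/= mulr0 subr0 add0r mulr_ge0//.
  by rewrite invr_ge0 exprn_ge0// ltW.
by apply: absb_ge0 => s.
Qed.

(** By monotonicity it is enough to look at the constant temperatures 0 and C, which act as sub- and
    supersolution. *)
Lemma bmf_source T : bmf C T -> bmf C (source T).
Proof.
move=> bT; split.
  have mT := bT.1.
  apply: measurable_funD => //; apply: measurable_funM => //.
  apply: measurable_funB; last first.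
    by apply: measurable_funM => //; exact: measurable_funX.
  apply: measurable_absb; first exact: measurable_funX.
  exact: bmf_nonneg (bmfX4 bT).
move=> x; apply/andP; split.
  apply: le_trans (source0_ge0 x) _; apply: source_ler => //.
  by split=> // y; rewrite lexx C_ge0.
  by move=> s; exact: bmf_nonneg bT s.
apply: le_trans (source_cst_le x); apply: source_ler => //; first exact: bmf_cst.
by move=> s; have /andP[] := bT.2 s.
Qed.

Let ik_neq0 : kappa^-1 != 0. Proof. by rewrite invr_eq0 gt_eqF. Qed.
Let nik_neq0 : - kappa^-1 != 0. Proof. by rewrite oppr_eq0. Qed.

Lemma step_ler T T' x : bmf C T -> bmf C T' -> (forall s, T s <= T' s) ->
  step T x <= step T' x.
Proof.
move=> bT bT' TT'; rewrite lerD2l.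
have b1 := bmf_sweep (bmf_source bT) nik_neq0.
have b2 := bmf_sweep (bmf_source bT') nik_neq0.
apply: (sweep_ler x b1 b2 ik_neq0) => s _.
apply: (sweep_ler s (bmf_source bT) (bmf_source bT') nik_neq0) => t _.
exact: source_ler.
Qed.

Lemma bmf_step T : bmf C T -> bmf C (step T).
Proof.
move=> bT; have b1 := bmf_sweep (bmf_source bT) nik_neq0.
split.
  apply: measurable_funD; last by have [] := bmf_sweep b1 ik_neq0.
  apply: measurable_funM => //.
  apply: (measurableT_comp (@measurable_expR R)).
  by apply: measurable_funM => //; exact: measurable_clip.
move=> x; apply/andP; split.
  rewrite addr_ge0 ?mulr_ge0 ?expR_ge0// sweep_ge0// => s _.
  exact: bmf_nonneg b1 s.
have := sweep_le x b1 ik_neq0; rewrite invr_gt0 kappa_gt0 mul1r invrK /step.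
rewrite mulNr [kappa * _]mulrC; set e := expR _ => h.
have e0 : 0 <= e by exact: expR_ge0.
have := ler_wpM2r e0 TbC; lra.
Qed.

Fixpoint iterate n : R -> R := if n is n'.+1 then step (iterate n') else cst 0.

Lemma bmf_iterate n : bmf C (iterate n).
Proof.
elim: n => [|n IH]; last exact: bmf_step.
by split=> // x; rewrite lexx C_ge0.
Qed.

Lemma iterateS_ge n x : iterate n x <= iterate n.+1 x.
Proof.
elim: n x => [|n IH] x; first exact: bmf_nonneg (bmf_iterate 1) x.
exact: step_ler (bmf_iterate n) (bmf_iterate n.+1) IH.
Qed.

Definition temperature x : R := limn (iterate ^~ x).

Lemma iterate_cvg x : iterate n x @[n --> \oo] --> temperature x.
Proof.
apply: nondecreasing_is_cvgn.
  by apply/nondecreasing_seqP => n; exact: iterateS_ge.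
by exists C => _ [n _ <-]; have /andP[] := (bmf_iterate n).2 x.
Qed.

Lemma bmf_temperature : bmf C temperature.
Proof.
split.
  apply: (@measurable_fun_cvg _ _ _ setT iterate); first by move=> n; have [] := bmf_iterate n.
  by move=> x _; exact: iterate_cvg.
move=> x; apply/andP; split.
  apply: limr_ge; first exact: iterate_cvg.
  by apply: nearW => n; exact: bmf_nonneg (bmf_iterate n) x.
apply: limr_le; first exact: iterate_cvg.
by apply: nearW => n; have /andP[] := (bmf_iterate n).2 x.
Qed.

(** At this stage the limit is only known to be bounded and measurable. Dominated convergence goes
    through the layers of [step] one at a time, with the constants C and C^4 as dominating factors;
    smoothness is deduced later from the equation itself. *)
Lemma temperature_fixpoint x : temperature x = step temperature x.
Proof.
have cX s : iterate n s ^+ 4 @[n --> \oo] --> temperature s ^+ 4.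
  apply: (@cvg_comp _ _ _ _ (fun y : R => y ^+ 4)); first exact: iterate_cvg.
  exact: exprn_continuous.
have cabs s : absb (fun t => iterate n t ^+ 4) s @[n --> \oo] -->
    absb (fun t => temperature t ^+ 4) s.
  apply: (@cvg_Rintegral_bounded _ _ (C ^+ 4)).
  - move=> n; have [mS _] := bmfX4 (bmf_iterate n).
    by apply: measurable_funTS; apply: measurable_rad1; [exact: mS|exact: bmf_nonneg (bmfX4 (bmf_iterate n))].
  - have [mS _] := bmfX4 bmf_temperature.
    by apply: measurable_funTS; apply: measurable_rad1; [exact: mS|exact: bmf_nonneg (bmfX4 bmf_temperature)].
  - move=> n mu Dmu; rewrite ger0_norm; first exact: (rad_le _ (bmfX4 (bmf_iterate n))).
    by apply: rad_ge0; exact: bmf_nonneg (bmfX4 (bmf_iterate n)).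
  - move=> mu Dmu; rewrite ger0_norm; first exact: (rad_le _ (bmfX4 bmf_temperature)).
    by apply: rad_ge0; exact: bmf_nonneg (bmfX4 bmf_temperature).
  - move=> mu Dmu; apply: cvgD; first exact: cvg_cst.
    apply: (@sweep_cvg _ _ _ (C ^+ 4)).
    + by move=> n; exact: bmfX4 (bmf_iterate n).
    + exact: bmfX4 bmf_temperature.
    + exact: D_neq0.
    + by move=> t _; exact: cX.
have csrc s : source (iterate n) s @[n --> \oo] --> source temperature s.
  apply: cvgD; first exact: iterate_cvg.
  apply: cvgM; first exact: cvg_cst.
  apply: cvgB; first exact: cabs.
  by apply: cvgM; [exact: cvg_cst|exact: cX].
have cstep : step (iterate n) x @[n --> \oo] --> step temperature x.
  apply: cvgD; first exact: cvg_cst.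
  apply: (@sweep_cvg _ _ _ C) => //.
  - by move=> n; exact: bmf_sweep (bmf_source (bmf_iterate n)) nik_neq0.
  - exact: bmf_sweep (bmf_source bmf_temperature) nik_neq0.
  - move=> s _; apply: (@sweep_cvg _ _ _ C) => //.
    + by move=> n; exact: bmf_source (bmf_iterate n).
    + exact: bmf_source bmf_temperature.
have h : iterate n.+1 x @[n --> \oo] --> temperature x.
  by rewrite (cvg_shiftS (iterate ^~ x)); exact: iterate_cvg.
exact: (cvg_unique _ h cstep).
Qed.

End radiation.

Section regularity.
Context {R : realType}.
Implicit Types (f g T S : R -> R) (x mu s : R).
Notation leb := (@lebesgue_measure R).

Lemma half_C1_rad (pb : R -> R) S C mu : mu != 0 -> bmf C S -> continuous S ->
  half_C1 (rad pb S ^~ mu) (fun x => (S x - rad pb S x mu) / mu).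
Proof.
move=> mu0 bS cS.
have h1 := half_C1Z (pb mu) (half_C1_clip (half_C1_expR (- mu^-1))).
have h2 := half_C1D h1 (half_C1_sweep bS mu0 cS).
have e x : expR (- mu^-1 * Num.max x 0) = expR (- (Num.max x 0 / mu)).
  by rewrite mulNr mulrC.
apply: half_C1_eqfun (half_C1_eq h2 _) _ => x /=; rewrite e /rad//.
by ring.
Qed.

Lemma sweep0 f C mu : 0 < mu -> bmf C f -> sweep f 0 mu = 0.
Proof.
move=> mu0 bf; apply/eqP; rewrite eq_le sweep_ge0; last first.
  by move=> s _; exact: bmf_nonneg bf s.
have := sweep_le 0 bf (lt0r_neq0 mu0).
by rewrite mu0 mul1r maxxx mul0r oppr0 expR0 subrr mulr0 andbT.
Qed.

(** Regularity by bootstrap on the fixed point: q bounded makes w continuous, hence T is C^1; then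
    T^4, the absorption and q are continuous, so w is C^1, and so is T' = kappa (w - T). *)
Lemma exists_mild_solution (Tb C : R) (pb : R -> R) (D : set R) :
  0 <= Tb -> Tb <= C -> measurable_fun setT pb -> (forall mu, 0 <= pb mu) ->
  (forall mu, mu <= 0 -> pb mu = 0) -> measurable D -> D `<=` directions ->
  (forall mu, D mu -> mu != 0) -> (forall mu, D mu -> pb mu <= C ^+ 4) ->
  exists T dT : R -> R, [/\ bmf C T, T 0 = Tb, half_C1 T dT &
    half_C1 dT (fun x => \int[leb]_(mu in D)
      (T x ^+ 4 - rad pb (fun s => T s ^+ 4) x mu))].
Proof.
move=> Tb0 TbC mpb pb0 pbN mD Ddir Dneq0 DC.
have C0 : 0 <= C by exact: le_trans TbC.
pose kappa := 1 + 8 * C ^+ 3.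
have C30 : 0 <= C ^+ 3 by exact: exprn_ge0.
have k0 : 0 < kappa by rewrite /kappa; lra.
have kC : 8 * C ^+ 3 <= kappa ^+ 2 by rewrite /kappa; nra.
pose T := temperature Tb kappa pb D.
have bT : bmf C T by exact: bmf_temperature.
have TE x : T x = step Tb kappa pb D T x by exact: (@temperature_fixpoint _ _ C).
pose S := fun s => T s ^+ 4.
have bS : bmf (C ^+ 4) S by exact: bmfX4.
have S0 := bmf_nonneg bS.
pose q := source kappa pb D T.
have bq : bmf C q by exact: (@bmf_source _ Tb).
have ik0 : kappa^-1 != 0 by rewrite invr_eq0 gt_eqF.
have nik0 : - kappa^-1 != 0 by rewrite oppr_eq0.
pose w := sweep q ^~ (- kappa^-1).
have bw : bmf C w by exact: bmf_sweep.
have cw : continuous w by exact: continuous_sweep bq nik0.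
have hT0 := half_C1_clip (half_C1_expR (- kappa)).
have hT1 := half_C1D (half_C1Z Tb hT0) (half_C1_sweep bw ik0 cw).
pose dT x := kappa * (w x - T x).
have hT : half_C1 T dT.
  apply: half_C1_eqfun (half_C1_eq hT1 _) _ => x /=; last by rewrite TE.
  by rewrite /dT TE /step -/q -/w; field; rewrite gt_eqF.
have cT : continuous T by have [] := hT.
have cS : continuous S.
  by move=> x; apply: (@continuous_comp _ _ _ T (fun y => y ^+ 4)); [exact: cT|exact: exprn_continuous].
have cabs : continuous (absb pb D S).
  apply: (@continuous_Rintegral _ _ _ (C ^+ 4)) => //.
  - exact: leb_D_fin.
  - by move=> x; apply: measurable_funTS; apply: measurable_rad1 => //; have [] := bS.
  - move=> x mu Dmu; rewrite ger0_norm; last exact: rad_ge0.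
    exact: (rad_le pbN Dneq0 DC).
  - by move=> mu /Dneq0 mu0; have [] := half_C1_rad pb mu0 bS cS.
have cq : continuous q.
  move=> x; apply: cvgD; first exact: cT.
  apply: cvgM; first exact: cvg_cst.
  apply: cvgB; first exact: cabs.
  by apply: cvgM; [exact: cvg_cst|exact: cS].
have hdT := half_C1Z kappa (half_C1B (half_C1_sweep bq nik0 cq) hT).
exists T, dT; split.
- exact: bT.
- by rewrite TE /step maxxx mulr0 expR0 mulr1 (sweep0 _ bw) ?addr0 ?invr_gt0.
- exact: hT.
- apply: half_C1_eq hdT _ => x.
  rewrite RintegralB; first last.
  + exact: (integrable_rad mpb pb0 pbN mD Ddir Dneq0 DC x bS).
  + apply: (@bounded_integrable _ _ _ leb _ _ (C ^+ 4)); first exact: mD.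
    * exact: leb_D_fin.
    * exact: measurable_cst.
    * by move=> mu _; rewrite ger0_norm; have /andP[] := bS.2 x.
  + exact: mD.
  rewrite Rintegral_cst; last exact: mD.
  rewrite -/(S x) -/(absb pb D S x) /dT.
  have -> : q x = T x + (kappa ^+ 2)^-1 * (absb pb D S x - fine (leb D) * S x) by [].
  rewrite -/(w x); field; rewrite gt_eqF//.
Qed.

End regularity.

(** * Energy and flux *)

Section bounded_on.
Context {R : realType}.
Notation leb := (@lebesgue_measure R).
Variable D : set R.
Hypothesis mD : measurable D.
Hypothesis D_directions : D `<=` directions.
Hypothesis D_full : leb (directions `\` D) = 0%E.
Implicit Types (f g : R -> R).

Definition bd f := measurable_fun D f /\ exists B, forall mu, D mu -> `|f mu| <= B.
Definition av f := \int[leb]_(mu in D) f mu.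

Lemma bd_cst (c : R) : bd (fun=> c).
Proof. by split; [exact: measurable_cst|exists `|c|]. Qed.

Lemma bd_id : bd (fun mu => mu).
Proof.
split; first exact: measurable_id.
exists 1 => mu /D_directions; rewrite /directions/= in_itv/= => /andP[h1 h2].
by rewrite ler_norml h1 h2.
Qed.

Lemma bdD f g : bd f -> bd g -> bd (fun mu => f mu + g mu).
Proof.
move=> [mf [B fB]] [mg [B' gB]]; split; first exact: measurable_funD.
exists (B + B') => mu Dmu; apply: le_trans (ler_normD _ _) _.
by apply: lerD; [exact: fB|exact: gB].
Qed.

Lemma bdB f g : bd f -> bd g -> bd (fun mu => f mu - g mu).
Proof.
move=> [mf [B fB]] [mg [B' gB]]; split; first exact: measurable_funB.
exists (B + B') => mu Dmu; apply: le_trans (ler_normB _ _) _.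
by apply: lerD; [exact: fB|exact: gB].
Qed.

Lemma bdM f g : bd f -> bd g -> bd (fun mu => f mu * g mu).
Proof.
move=> [mf [B fB]] [mg [B' gB]]; split; first exact: measurable_funM.
exists (B * B') => mu Dmu; rewrite normrM.
by apply: ler_pM => //; [exact: fB|exact: gB].
Qed.

Lemma bdX f n : bd f -> bd (fun mu => f mu ^+ n).
Proof.
move=> [mf [B fB]]; split; first exact: measurable_funX.
exists (B ^+ n) => mu Dmu; rewrite normrX lerXn2r ?nnegrE ?fB//.
by apply: le_trans (fB mu Dmu).
Qed.

Lemma bd_integrable f : bd f -> leb.-integrable D (EFin \o f).
Proof.
move=> [mf [B fB]]; apply: (@bounded_integrable _ _ _ leb _ _ B) => //.
exact: leb_D_fin.
Qed.

Lemma avD f g : bd f -> bd g -> av (fun mu => f mu + g mu) = av f + av g.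
Proof. by move=> bf bg; rewrite /av RintegralD//; exact: bd_integrable. Qed.

Lemma avB f g : bd f -> bd g -> av (fun mu => f mu - g mu) = av f - av g.
Proof. by move=> bf bg; rewrite /av RintegralB//; exact: bd_integrable. Qed.

Lemma avZ (c : R) f : bd f -> av (fun mu => c * f mu) = c * av f.
Proof. by move=> bf; rewrite /av RintegralZl//; exact: bd_integrable. Qed.

Lemma eq_av f g : (forall mu, D mu -> f mu = g mu) -> av f = av g.
Proof. by move=> fg; apply: eq_Rintegral => mu; rewrite inE => /fg. Qed.

Lemma av_le f g : bd f -> bd g -> (forall mu, D mu -> f mu <= g mu) -> av f <= av g.
Proof. by move=> bf bg fg; apply: le_Rintegral => //; exact: bd_integrable. Qed.

Lemma av_ge0 f : (forall mu, D mu -> 0 <= f mu) -> 0 <= av f.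
Proof. by move=> f0; exact: Rintegral_ge0. Qed.

Lemma norm_av_le f g : bd f -> bd g -> (forall mu, D mu -> `|f mu| <= g mu) ->
  `|av f| <= av g.
Proof.
move=> bf bg fg; rewrite ler_norml; apply/andP; split.
  rewrite -mulN1r -avZ//; apply: av_le => //.
    by apply: bdM => //; exact: bd_cst.
  by move=> mu Dmu; rewrite mulN1r; have := fg mu Dmu; rewrite ler_norml => /andP[].
by apply: av_le => // mu Dmu; apply: le_trans (ler_norm _) (fg mu Dmu).
Qed.

Lemma norm_av_bound f B : bd f -> (forall mu, D mu -> `|f mu| <= B) -> 0 <= B ->
  `|av f| <= 2 * B.
Proof.
move=> bf fB B0; apply: le_trans (norm_av_le bf (bd_cst B) fB) _.
rewrite /av Rintegral_cst// mulrC ler_wpM2r//.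
by have /andP[] := mass_bounds mD D_directions.
Qed.

Lemma av_directions f : measurable_fun directions f ->
  (exists B, forall mu, directions mu -> `|f mu| <= B) ->
  av f = \int[leb]_(mu in directions) f mu.
Proof.
move=> mf [B fB].
have mdir : measurable (@directions R) by exact: measurable_itv.
have intf : leb.-integrable directions (EFin \o f).
  apply: (@bounded_integrable _ _ _ leb _ _ B) => //.
  by rewrite /= leb_directions ltry.
rewrite /av /Rintegral [in RHS](@negligible_integral _ _ _ leb _ (directions `\` D))//.
  by rewrite setDD setIidr.
exact: measurableD.
Qed.

Lemma integral_directions_FTC (F f : R -> R) :
  continuous F -> continuous f -> (forall x : R, is_derive x 1 F (f x)) ->
  \int[leb]_(mu in directions) f mu = F 1 - F (-1).
Proof.
move=> cF cf F'; rewrite /Rintegral /directions (@continuous_FTC2 _ _ F)//.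
- exact: continuous_subspaceT.
- split.
  + by move=> x _; have [] := F' x.
  + exact/cvg_at_right_filter/cF.
  + exact/cvg_at_left_filter/cF.
- by move=> x _; rewrite derive1E; exact: (@derive_val _ _ _ _ _ _ _ (F' x)).
Qed.

Lemma av_mu : av (fun mu => mu) = 0.
Proof.
rewrite av_directions; last first.
- exists 1 => mu; rewrite /directions/= in_itv/= => /andP[h1 h2].
  by rewrite ler_norml h1 h2.
- exact: measurable_id.
have F' (x : R) : is_derive x 1 (fun x : R => 2^-1 * (x * x)) x.
  by apply: is_derive_eq; rewrite /GRing.scale/=; field.
rewrite (integral_directions_FTC _ _ F').
- by rewrite mulrNN subrr.
- by move=> x; apply: cvgM; [exact: cvg_cst|apply: cvgM; exact: cvg_id].
- by move=> x; exact: cvg_id.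
Qed.

(** Weighted by t/2 in [flux_young], this moment gives the term t/3, the origin of the 6 in
    [decay_const]. *)
Lemma av_mu2 : av (fun mu => mu ^+ 2) = 2 / 3.
Proof.
rewrite av_directions; last first.
- exists 1 => mu; rewrite /directions/= in_itv/= => /andP[h1 h2].
  by rewrite normrX expr_le1// ler_norml h1 h2.
- by apply: measurable_funX; exact: measurable_id.
have F' (x : R) : is_derive x 1 (fun x : R => 3^-1 * (x * (x * x))) (x ^+ 2).
  by apply: is_derive_eq; rewrite /GRing.scale/= expr2; field.
rewrite (integral_directions_FTC _ _ F').
- by field.
- move=> x; apply: cvgM; [exact: cvg_cst|apply: cvgM; first exact: cvg_id].
  by apply: cvgM; exact: cvg_id.
- by move=> x; exact: exprn_continuous.
Qed.

End bounded_on.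

Section milne_estimates.
Context {R : realType}.
Notation leb := (@lebesgue_measure R).
Variables (C : R) (T dT : R -> R) (psi : R -> R -> R) (D : set R).
Hypothesis mD : measurable D.
Hypothesis D_directions : D `<=` directions.
Hypothesis D_full : leb (directions `\` D) = 0%E.
Hypothesis D_neq0 : forall mu, D mu -> mu != 0.
Let S x := T x ^+ 4.
Hypothesis bT : bmf C T.
Hypothesis hT : half_C1 T dT.
Hypothesis hdT : half_C1 dT (fun x => \int[leb]_(mu in D) (S x - psi x mu)).
Hypothesis hpsi : forall mu, D mu ->
  half_C1 (psi ^~ mu) (fun x => (S x - psi x mu) / mu).
Hypothesis mpsi : forall x, measurable_fun D (psi x).
Hypothesis psi_bounds : forall x mu, D mu -> 0 <= psi x mu <= C ^+ 4.

Local Notation av := (av D).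
Local Notation bd := (bd D).

Let C_ge0 : 0 <= C. Proof. exact: bmf_ge0 bT. Qed.

Let S_bounds x : 0 <= S x <= C ^+ 4.
Proof. by have [_ /(_ x)] := bmfX4 bT. Qed.

Let bd_psi x : bd (psi x).
Proof.
split=> //; exists (C ^+ 4) => mu /(psi_bounds x)/andP[p0 pC].
by rewrite ger0_norm.
Qed.

Let bd_diff x : bd (fun mu => S x - psi x mu).
Proof. by apply: bdB; [exact: bd_cst|exact: bd_psi]. Qed.

Let diff_le x mu : D mu -> `|S x - psi x mu| <= C ^+ 4.
Proof.
move=> Dmu; have /andP[s0 sC] := S_bounds x.
have /andP[p0 pC] := psi_bounds x Dmu.
by rewrite ler_norml; apply/andP; split; lra.
Qed.

Let psi_le x mu : D mu -> `|psi x mu| <= C ^+ 4.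
Proof. by move=> Dmu; have /andP[p0 pC] := psi_bounds x Dmu; rewrite ger0_norm. Qed.

Let mu_le1 mu : D mu -> `|mu| <= 1.
Proof.
move=> /D_directions; rewrite /directions/= in_itv/= => /andP[h1 h2].
by rewrite ler_norml h1 h2.
Qed.

Let C4 : 0 <= C ^+ 4. Proof. exact: exprn_ge0. Qed.

Let bd_mu : bd (fun mu => mu). Proof. exact: bd_id. Qed.

Lemma half_C1_moment1 : half_C1 (fun x => av (fun mu => mu * psi x mu))
  (fun x => av (fun mu => S x - psi x mu)).
Proof.
apply: (@half_C1_Rintegral _ _ _ _ (C ^+ 4)) => //.
- exact: leb_D_fin.
- by move=> x; have [] := bdM bd_mu (bd_psi x).
- by move=> x; have [] := bd_diff x.
- move=> x mu Dmu; rewrite normrM -[leRHS]mul1r; apply: ler_pM => //.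
    exact: mu_le1.
  exact: psi_le.
- by move=> mu Dmu; apply: half_C1_eq (half_C1Z mu (hpsi Dmu)) _ => x;
    rewrite mulrC divfK// D_neq0.
Qed.

Lemma half_C1_moment2 : half_C1 (fun x => av (fun mu => mu ^+ 2 * psi x mu))
  (fun x => - av (fun mu => mu * psi x mu)).
Proof.
have h : half_C1 (fun x => av (fun mu => mu ^+ 2 * psi x mu))
    (fun x => av (fun mu => mu * (S x - psi x mu))).
  apply: (@half_C1_Rintegral _ _ _ _ (C ^+ 4)) => //.
  - exact: leb_D_fin.
  - by move=> x; have [] := bdM (bdX 2 bd_mu) (bd_psi x).
  - by move=> x; have [] := bdM bd_mu (bd_diff x).
  - move=> x mu Dmu; rewrite normrM -[leRHS]mul1r; apply: ler_pM => //.
      by rewrite normrX expr_le1// mu_le1.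
    exact: psi_le.
  - move=> x mu Dmu; rewrite normrM -[leRHS]mul1r; apply: ler_pM => //.
      exact: mu_le1.
    exact: diff_le.
  - move=> mu Dmu; apply: half_C1_eq (half_C1Z (mu ^+ 2) (hpsi Dmu)) _ => x.
    by field; exact: D_neq0.
apply: half_C1_eq h _ => x.
transitivity (av (fun mu => S x * mu - mu * psi x mu)).
  by apply: eq_av => mu _; ring.
rewrite avB ?avZ// ?av_mu// ?mulr0 ?sub0r//.
  by apply: bdM => //; exact: bd_cst.
exact: bdM.
Qed.

(* T + <mu^2 psi> grows linearly with slope T' - <mu psi>, yet it is bounded. *)
Lemma flux_eq x : 0 <= x -> dT x = av (fun mu => mu * psi x mu).
Proof.
have h1 := half_C1B hdT half_C1_moment1.
pose c := dT 0 - av (fun mu => mu * psi 0 mu).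
have hc y : 0 <= y -> dT y - av (fun mu => mu * psi y mu) = c.
  move=> y0; apply: (half_C1_cst0 h1) => // z _.
  by rewrite -/(av _) subrr.
have h2 := half_C1B (half_C1D hT half_C1_moment2) (half_C1Z c half_C1_id).
have hk y : 0 <= y -> T y + av (fun mu => mu ^+ 2 * psi y mu) - c * y =
    T 0 + av (fun mu => mu ^+ 2 * psi 0 mu) - c * 0.
  move=> y0; apply: (half_C1_cst0 h2) => // z z0.
  by rewrite mulr1 (hc z (ltW z0)) subrr.
have bnd y : `|T y + av (fun mu => mu ^+ 2 * psi y mu)| <= C + 2 * C ^+ 4.
  apply: le_trans (ler_normD _ _) _; apply: lerD.
    by have /andP[t0 tC] := bT.2 y; rewrite ger0_norm.
  apply: norm_av_bound => //; first exact: bdM (bdX 2 bd_mu) (bd_psi y).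
  move=> mu Dmu; rewrite normrM -[leRHS]mul1r; apply: ler_pM => //.
    by rewrite normrX expr_le1// mu_le1.
  exact: psi_le.
set B := C + _ in bnd.
have c0 : c = 0.
  apply/eqP; apply: contraT => cn0.
  have nc : 0 < `|c| by rewrite normr_gt0.
  have B0 : 0 <= B by apply: le_trans (bnd 0); exact: normr_ge0.
  (* Over [0, y] the linear term varies by |c| y = 2 B + 1, while a quantity bounded by B varies by
     at most 2 B. *)
  pose y := (2 * B + 1) / `|c|.
  have y0 : 0 <= y by rewrite divr_ge0// addr_ge0// mulr_ge0.
  have : `|c * y| <= 2 * B.
    have -> : c * y = (T y + av (fun mu => mu ^+ 2 * psi y mu)) -
        (T 0 + av (fun mu => mu ^+ 2 * psi 0 mu)).
      by have := hk y y0; rewrite mulr0 subr0 => <-; ring.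
    by apply: le_trans (ler_normB _ _) _; have := bnd y; have := bnd 0; lra.
  rewrite normrM (ger0_norm y0) /y mulrC divfK ?gt_eqF//.
  by rewrite leNgt ltrDl ltr01.
move=> x0; have := hc x x0; rewrite c0 => /eqP.
by rewrite subr_eq0 => /eqP.
Qed.

Definition energy x := 2^-1 * av (fun mu => mu * (psi x mu - S x) ^+ 2).
Definition dissipation x := av (fun mu => (psi x mu - S x) ^+ 2).

Let bd_sq x : bd (fun mu => (psi x mu - S x) ^+ 2).
Proof. by apply: bdX; apply: bdB; [exact: bd_psi|exact: bd_cst]. Qed.

Let bd_musq x : bd (fun mu => mu * (psi x mu - S x) ^+ 2).
Proof. exact: bdM. Qed.

Lemma dissipation_ge0 x : 0 <= dissipation x.
Proof. by apply: av_ge0 => mu _; exact: sqr_ge0. Qed.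

(** Only |mu| <= 1 is at work. This comparison lets a weight e^{2 a x} with a < 1 be absorbed by the
    dissipation, and also gives the sign of the energy. *)
Lemma energy_dissipation x : `|2 * energy x| <= dissipation x.
Proof.
rewrite /energy mulrA divff ?mul1r//; apply: norm_av_le => //.
move=> mu Dmu; rewrite normrM [`|_ ^+ 2|]ger0_norm ?sqr_ge0//.
by rewrite -[leRHS]mul1r ler_wpM2r ?sqr_ge0 ?mu_le1.
Qed.

Lemma half_C1_S : half_C1 S (fun x => 4 * T x ^+ 3 * dT x).
Proof. exact: half_C1X 3 hT. Qed.

Lemma continuous_dissipation : continuous dissipation.
Proof.
apply: (@continuous_Rintegral _ _ _ ((C ^+ 4) ^+ 2)) => //.
- exact: leb_D_fin.
- by move=> x; have [] := bd_sq x.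
- by move=> x mu Dmu; rewrite normrX lerXn2r ?nnegrE// distrC diff_le.
- move=> mu Dmu; have [h _ _] := half_C1X 1 (half_C1B (hpsi Dmu) half_C1_S).
  exact: h.
Qed.

Lemma half_C1_energy : half_C1 energy
  (fun x => - (4 * T x ^+ 3 * dT x * av (fun mu => mu * psi x mu)) - dissipation x).
Proof.
(* Since <mu> = 0, 2 E = <mu psi^2> - 2 S <mu psi>. *)
have hQ : half_C1 (fun x => av (fun mu => mu * psi x mu ^+ 2))
    (fun x => av (fun mu => 2 * (psi x mu * (S x - psi x mu)))).
  apply: (@half_C1_Rintegral _ _ _ _ (2 * (C ^+ 4 * C ^+ 4))) => //.
  - exact: leb_D_fin.
  - by move=> x; have [] := bdM bd_mu (bdX 2 (bd_psi x)).
  - by move=> x; have [] := bdM (bd_cst D 2) (bdM (bd_psi x) (bd_diff x)).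
  - move=> x mu Dmu; rewrite normrM normrX expr2.
    have h1 := mu_le1 Dmu; have h2 := psi_le x Dmu.
    have h3 : `|psi x mu| * `|psi x mu| <= C ^+ 4 * C ^+ 4 by exact: ler_pM.
    have := ler_pM (normr_ge0 _) (mulr_ge0 (normr_ge0 _) (normr_ge0 _)) h1 h3.
    by rewrite mul1r; have := mulr_ge0 C4 C4; lra.
  - move=> x mu Dmu; rewrite !normrM ger0_norm// ler_wpM2l//.
    by apply: ler_pM => //; [exact: psi_le|exact: diff_le].
  - move=> mu Dmu; apply: half_C1_eq (half_C1Z mu (half_C1X 1 (hpsi Dmu))) _ => x.
    by rewrite expr1; field; exact: D_neq0.
have h := half_C1B (half_C1Z 2^-1 hQ) (half_C1M half_C1_S half_C1_moment1).
apply: half_C1_eqfun (half_C1_eq h _) _ => x.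
  rewrite avZ//; last exact: bdM.
  rewrite mulrA mulVf// mul1r.
  have -> : av (fun mu => psi x mu * (S x - psi x mu)) =
      S x * av (fun mu => S x - psi x mu) - dissipation x.
    rewrite -avZ// -avB//; last by apply: bdM => //; exact: bd_cst.
    by apply: eq_av => mu _; ring.
  ring.
rewrite /energy.
have -> : av (fun mu => mu * (psi x mu - S x) ^+ 2) =
    av (fun mu => mu * psi x mu ^+ 2) - 2 * S x * av (fun mu => mu * psi x mu) +
    S x ^+ 2 * av (fun mu => mu).
  have b1 : bd (fun mu => mu * psi x mu ^+ 2) by apply: bdM => //; exact: bdX.
  have b2 : bd (fun mu => mu * psi x mu) by exact: bdM.
  rewrite -!avZ// -avB//; last by apply: bdM => //; exact: bd_cst.
  rewrite -avD//.
  - by apply: eq_av => mu _; ring.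
  - by apply: bdB => //; apply: bdM => //; exact: bd_cst.
  - by apply: bdM => //; exact: bd_cst.
by rewrite av_mu//; field.
Qed.

Let T_ge0 x : 0 <= T x. Proof. by have /andP[] := bT.2 x. Qed.

(** The integrand changes sign with mu, so the sign must come from the dynamics: E' <= - 2 |E|
    implies E' <= 2 E, and a negative value would be amplified like e^{2x}, against boundedness. The
    sign is what allows the energy at the far end to be dropped later. *)
Lemma energy_ge0 x : 0 <= x -> 0 <= energy x.
Proof.
apply: (@half_C1_bounded_ge0 _ energy _ (-2) (2^-1 * (2 * (C ^+ 4) ^+ 2)) half_C1_energy).
- by rewrite oppr_lt0.
- move=> y _; rewrite normrM ger0_norm ?invr_ge0// ler_wpM2l ?invr_ge0//.
  apply: norm_av_bound => //; last exact: exprn_ge0.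
  move=> mu Dmu; rewrite normrM -[leRHS]mul1r; apply: ler_pM => //.
    exact: mu_le1.
  by rewrite normrX lerXn2r ?nnegrE// distrC diff_le.
- move=> y y0; rewrite -(flux_eq (ltW y0)).
  have := energy_dissipation y; rewrite ler_norml => /andP[h1 h2].
  have h3 : 0 <= 4 * T y ^+ 3 * dT y * dT y.
    rewrite -mulrA; apply: mulr_ge0; first by rewrite mulr_ge0// exprn_ge0.
    by rewrite -expr2 sqr_ge0.
  lra.
Qed.

(** Differentiating the weight produces a * (2 E), at most [a] times the dissipation, so the share 1
    - a remains. The derivative itself stays existential: later arguments use its continuity and
    this upper bound. *)
Lemma half_C1_weighted_energy (a : R) :
  exists d, half_C1 (fun x => expR (2 * a * x) * energy x) d /\
    forall x, 0 <= x -> 0 <= a ->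
      expR (2 * a * x) * (4 * T x ^+ 3 * dT x ^+ 2 + (1 - a) * dissipation x) <= - d x.
Proof.
eexists; split; first exact: half_C1M (half_C1_expR (2 * a)) half_C1_energy.
move=> x x0 a0 /=; rewrite -(flux_eq x0).
have -> : - (2 * a * expR (2 * a * x) * energy x + expR (2 * a * x) *
    (- (4 * T x ^+ 3 * dT x * dT x) - dissipation x)) =
  expR (2 * a * x) * (4 * T x ^+ 3 * dT x ^+ 2 + dissipation x - a * (2 * energy x)).
  by ring.
apply: ler_wpM2l; first exact: expR_ge0.
have := energy_dissipation x; rewrite ler_norml => /andP[h1 h2].
have := ler_wpM2l a0 h2; lra.
Qed.

Lemma weighted_energy_le (a x y : R) : 0 <= a < 1 -> 0 <= x -> x <= y ->
  expR (2 * a * y) * energy y <= expR (2 * a * x) * energy x.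
Proof.
move=> /andP[a0 a1] x0 xy.
have [d [hd dle]] := half_C1_weighted_energy a.
apply: (half_C1_le0 hd) => // z z0; rewrite -oppr_ge0.
apply: le_trans (dle z (ltW z0) a0); rewrite mulr_ge0 ?expR_ge0// addr_ge0//.
  by rewrite mulr_ge0 ?sqr_ge0// mulr_ge0// exprn_ge0.
by rewrite mulr_ge0 ?dissipation_ge0// subr_ge0 ltW.
Qed.

(** Since <mu> = 0, psi may be replaced by psi - S in the flux. Young's inequality, unlike
    Cauchy-Schwarz, leaves the dissipation linear, so that it can be compared pointwise with the
    derivative of the weighted energy. *)
Lemma flux_young x (t : R) : 0 <= x -> 0 < t ->
  `|dT x| <= t / 3 + dissipation x / (2 * t).
Proof.
move=> x0 t0; rewrite flux_eq//.
have b1 : bd (fun mu => mu * (psi x mu - S x)).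
  by apply: bdM => //; apply: bdB; [exact: bd_psi|exact: bd_cst].
have -> : av (fun mu => mu * psi x mu) = av (fun mu => mu * (psi x mu - S x)).
  transitivity (av (fun mu => mu * psi x mu) - S x * av (fun mu => mu)).
    by rewrite av_mu// mulr0 subr0.
  rewrite -avZ// -avB//.
  - by apply: eq_av => mu _; ring.
  - exact: bdM.
  - by apply: bdM => //; exact: bd_cst.
have b2 : bd (fun mu => t / 2 * mu ^+ 2) by apply: bdM; [exact: bd_cst|exact: bdX].
have b3 : bd (fun mu => (2 * t)^-1 * (psi x mu - S x) ^+ 2).
  by apply: bdM => //; exact: bd_cst.
have -> : t / 3 + dissipation x / (2 * t) =
    av (fun mu => t / 2 * mu ^+ 2 + (2 * t)^-1 * (psi x mu - S x) ^+ 2).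
  rewrite avD// !avZ//; last exact: bdX.
  by rewrite av_mu2// -/(dissipation x); field; rewrite gt_eqF.
apply: norm_av_le => //; first exact: bdD.
move=> mu Dmu; set p := psi x mu - S x.
have e : t / 2 * mu ^+ 2 + (2 * t)^-1 * p ^+ 2 - `|mu * p| =
    (2 * t)^-1 * (t * `|mu| - `|p|) ^+ 2.
  rewrite normrM -(real_normK (num_real mu)) -(real_normK (num_real p)).
  by field; rewrite gt_eqF.
rewrite -subr_ge0 e; apply: mulr_ge0; last exact: sqr_ge0.
by rewrite invr_ge0 mulr_ge0// ltW.
Qed.

(** For either sign, sg T + lam e^{-2az} / (6 a) + k e^{2az} E(z) is nonincreasing in z. Comparing
    its values at x and y, where the last two terms are nonnegative, bounds the increment without
    integrating |T'|. *)
Lemma temperature_increment (a lam x y : R) : 0 < a < 1 -> 0 < lam ->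
  0 <= x -> x <= y ->
  `|T y - T x| <= lam * (expR (- 2 * a * x) / (6 * a)) + energy 0 / (2 * (1 - a)) / lam.
Proof.
move=> /andP[a0 a1] lam0 x0 xy.
have a01 : 0 <= a < 1 by rewrite ltW.
have a1' : 0 < 1 - a by rewrite subr_gt0.
pose k := (2 * (1 - a) * lam)^-1.
have k0 : 0 <= k by rewrite invr_ge0 !mulr_ge0// ltW.
have [d [hd dle]] := half_C1_weighted_energy a.
have he := half_C1Z (lam / (6 * a)) (half_C1_expR (- 2 * a)).
have key (sg : R) : `|sg| = 1 ->
  sg * (T y - T x) <= lam * (expR (- 2 * a * x) / (6 * a)) + energy 0 / (2 * (1 - a)) / lam.
  move=> sg1.
  have hH := half_C1D (half_C1D (half_C1Z sg hT) he) (half_C1Z k hd).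
  have : forall z, 0 < z -> sg * dT z + lam / (6 * a) * (- 2 * a * expR (- 2 * a * z)) +
      k * d z <= 0.
    move=> z z0.
    (* With this Young parameter, t/3 is the decay rate of the exponential term, and 1/t reproduces
       the weight e^{2az} in front of the dissipation. *)
    pose t := lam * expR (- 2 * a * z).
    have t0 : 0 < t by rewrite mulr_gt0 ?expR_gt0.
    have h1 := flux_young (ltW z0) t0.
    have h2 : sg * dT z <= `|dT z|.
      by apply: le_trans (ler_norm _) _; rewrite normrM sg1 mul1r.
    have h3 : expR (2 * a * z) * ((1 - a) * dissipation z) <= - d z.
      apply: le_trans (dle z (ltW z0) (ltW a0)); rewrite ler_wpM2l ?expR_ge0// lerDr.
      by rewrite mulr_ge0 ?sqr_ge0// mulr_ge0// exprn_ge0.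
    have h4 := ler_wpM2l k0 h3.
    have e1 : lam / (6 * a) * (- 2 * a * expR (- 2 * a * z)) = - (t / 3).
      by rewrite /t; field; rewrite gt_eqF.
    have e2 : k * (expR (2 * a * z) * ((1 - a) * dissipation z)) = dissipation z / (2 * t).
      rewrite /k /t (_ : - 2 * a * z = - (2 * a * z)); last by ring.
      rewrite expRN; field.
      by rewrite !gt_eqF ?expR_gt0.
    by rewrite e1; rewrite e2 in h4; lra.
  move=> /(half_C1_le0 hH) /(_ x y x0 xy) h.
  have w1 := weighted_energy_le a01 (lexx 0) x0.
  rewrite mulr0 expR0 mul1r in w1.
  have w2 : 0 <= k * (expR (2 * a * y) * energy y).
    by rewrite mulr_ge0// mulr_ge0 ?expR_ge0// energy_ge0// (le_trans x0).
  have w3 := ler_wpM2l k0 w1.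
  have w4 : 0 <= lam / (6 * a) * expR (- 2 * a * y).
    by rewrite mulr_ge0 ?expR_ge0// divr_ge0 ?mulr_ge0// ltW.
  have -> : lam * (expR (- 2 * a * x) / (6 * a)) = lam / (6 * a) * expR (- 2 * a * x).
    by ring.
  have -> : energy 0 / (2 * (1 - a)) / lam = k * energy 0.
    by rewrite /k; field; rewrite !gt_eqF.
  rewrite mulrBr; lra.
rewrite ler_norml; apply/andP; split.
  by rewrite lerNl; have := key (-1); rewrite mulN1r normrN normr1; exact.
by rewrite -[leLHS]mul1r; apply: key; rewrite normr1.
Qed.

Lemma weighted_dissipation_integral (a : R) : 0 <= a < 1 ->
  (\int[leb]_(x in half_line) (expR (2 * a * x) * (4 * T x ^+ 3 * `|dT x| ^+ 2))%:E +
   (1 - a)%:E * \int[leb]_(x in half_line) (expR (2 * a * x) * dissipation x)%:E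
   <= (energy 0)%:E)%E.
Proof.
move=> a01; have /andP[a0 a1] := a01.
have a1' : 0 <= 1 - a by rewrite subr_ge0 ltW.
have [d [hd dle]] := half_C1_weighted_energy a.
have mH := measurable_half_line (R := R).
have half0 (x : R) : half_line x -> 0 <= x by rewrite /half_line/= in_itv/= andbT.
have [cT _ _] := hT; have [cdT _ _] := hdT.
have [ce _ _] := half_C1_expR (2 * a).
pose A x := expR (2 * a * x) * (4 * T x ^+ 3 * `|dT x| ^+ 2).
pose N x := expR (2 * a * x) * dissipation x.
have A0 x : 0 <= A x by rewrite mulr_ge0 ?expR_ge0// mulr_ge0 ?sqr_ge0// mulr_ge0// exprn_ge0.
have N0 x : 0 <= N x by rewrite mulr_ge0 ?expR_ge0// dissipation_ge0.
have mexp : measurable_fun setT (fun x => expR (2 * a * x)).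
  exact: continuous_measurable_fun.
have mA : measurable_fun setT A.
  apply: measurable_funM => //; apply: measurable_funM; last first.
    apply: measurable_funX; apply: measurableT_comp => //.
    exact: continuous_measurable_fun.
  by apply: measurable_funM => //; apply: measurable_funX; exact: continuous_measurable_fun.
have mN : measurable_fun setT N.
  by apply: measurable_funM => //; apply: continuous_measurable_fun; exact: continuous_dissipation.
have AN x : 0 <= x -> A x + (1 - a) * N x <= - d x.
  move=> x0; apply: le_trans (dle x x0 a0); rewrite /A /N.
  rewrite real_normK ?num_real//.
  by rewrite mulrDr [(1 - a) * (_ * _)]mulrCA.
have mE (f : R -> R) : measurable_fun setT f -> measurable_fun half_line (EFin \o f).
  by move=> mf; apply/measurable_EFinP; exact: measurable_funTS.
have mE2 : measurable_fun half_line (fun x => ((1 - a)%:E * (N x)%:E)%E).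
  under eq_fun do rewrite -EFinM.
  by apply: (mE (fun x => (1 - a) * N x)); exact: measurable_funM.
have N0E x : half_line x -> (0 <= (N x)%:E)%E by rewrite lee_fin.
have A0E x : half_line x -> (0 <= (A x)%:E)%E by rewrite lee_fin.
have aE : (0 <= (1 - a)%:E)%E by rewrite lee_fin.
rewrite -(ge0_integralZl leb mH (mE N mN) N0E aE).
rewrite -(ge0_integralD leb mH A0E (mE A mA) _ mE2); last first.
  by move=> x /N0E h; exact: mule_ge0.
have cd : continuous d by have [] := hd.
apply: (@le_trans _ _ (\int[leb]_(x in half_line) (- d x)%:E)%E).
  apply: ge0_le_integral => //.
  - by move=> x _; rewrite adde_ge0 ?mule_ge0 ?lee_fin.
  - under eq_fun do rewrite -EFinM -EFinD.
    apply: (mE (fun x => A x + (1 - a) * N x)).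
    by apply: measurable_funD => //; exact: measurable_funM.
  - apply: (mE (fun x => - d x)); apply: continuous_measurable_fun => x.
    by apply: cvgN; exact: cd.
  - by move=> x /half0 x0; rewrite -EFinM -EFinD lee_fin AN.
pose W x := expR (2 * a * x) * energy x.
have W0 x : 0 <= x -> 0 <= W x by move=> x0; rewrite mulr_ge0 ?expR_ge0// energy_ge0.
(* Clipping makes it nondecreasing on the whole line, so it converges at infinity to the supremum of
   its range. That limit is at most 0 because the energy is nonnegative, and it is discarded. *)
pose F x := - W (Num.max x 0).
have Fnd : nondecreasing_fun F.
  move=> x y xy; rewrite /F lerN2; apply: weighted_energy_le => //.
    exact: clip_ge0.
  by rewrite ge_max !le_max xy lexx !orbT.
have Fub : ubound (range F) 0.
  by move=> _ [x _ <-]; rewrite oppr_le0; apply: W0; exact: clip_ge0.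
have Fl := nondecreasing_cvgr Fnd (ex_intro _ 0 Fub).
have l0 : sup (range F) <= 0 by apply: ge_sup => //; exists (F 0), 0.
have cW : continuous W by have [] := hd.
have W' (x : R) : 0 < x -> is_derive x 1 (fun x => - W x) (- d x).
  by move=> x0; have [_ _ /(_ x x0) h] := hd; exact: is_deriveN.
rewrite (@ge0_continuous_FTC2y _ _ (fun x => - W x) 0 (sup (range F))).
- rewrite -EFinB lee_fin opprK /W mulr0 expR0 mul1r.
  by rewrite gerDr.
- move=> x x0; apply: le_trans (AN x x0); rewrite addr_ge0//.
  by rewrite mulr_ge0.
- by apply: continuous_subspaceT => x; apply: cvgN; exact: cd.
- apply: cvg_trans Fl; apply: near_eq_cvg; near=> x.
  rewrite /F clipE//; near: x; apply: nbhs_pinfty_ge; exact: num_real.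
- by move=> x x0; have [] := W' x x0.
- by apply: cvg_at_right_filter; apply: cvgN; exact: cW.
- move=> x; rewrite in_itv/= andbT => x0; rewrite derive1E.
  exact: (@derive_val _ _ _ _ _ _ _ (W' x x0)).
Unshelve. all: end_near. Qed.

End milne_estimates.

(** * Optimisation in Young's parameter, limit at infinity, relaxation along a direction *)

Section decay.
Context {R : realType}.

(** The minimum of lam p + q / lam is 2 sqrt(p q) = K, reached at lam = K / (2 p). When K = 0 this
    value is not admissible; then q = 0 and a small lam contradicts d > 0. *)
Lemma young_optimum (d p q K : R) : 0 < p -> 0 <= K -> K ^+ 2 = 4 * p * q ->
  (forall lam, 0 < lam -> d <= lam * p + q / lam) -> d <= K.
Proof.
move=> p0; rewrite le_eqVlt => /predU1P[<-|K0] Kpq dle.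
  have q0 : q = 0.
    have : 4 * p * q = 0 by rewrite -Kpq expr0n.
    by move=> /eqP; rewrite !mulf_eq0 pnatr_eq0/= gt_eqF//= => /eqP.
  rewrite leNgt; apply/negP => d0.
  have lam0 : 0 < d / (2 * p) by rewrite divr_gt0// mulr_gt0.
  have := dle _ lam0; rewrite q0 mul0r addr0.
  have -> : d / (2 * p) * p = d / 2 by field; rewrite gt_eqF.
  lra.
have lam0 : 0 < K / (2 * p) by rewrite divr_gt0// mulr_gt0.
apply: le_trans (dle _ lam0) _.
have qE : q = K ^+ 2 / (4 * p) by rewrite Kpq; field; rewrite gt_eqF.
rewrite le_eqVlt; apply/orP; left; apply/eqP.
by rewrite qE; field; rewrite !gt_eqF.
Qed.

Lemma expRN_le (c e : R) : 0 < c -> 0 < e ->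
  exists y0 : R, forall y, y0 <= y -> expR (- (c * y)) <= e.
Proof.
move=> c0 e0; exists (e^-1 / c) => y ey.
rewrite expRN -[leRHS]invrK lef_pV2 ?posrE ?expR_gt0 ?invr_gt0//.
apply: le_trans (expR_ge1Dx _); rewrite -[leLHS]add0r lerD//.
by rewrite mulrC -ler_pdivrMr.
Qed.

(** The limit must be the same for all rates, so it is built from the rate 1/2 alone: every f x - r
    x lies below every f y + r y, and [l] is the supremum of the former. Any other rate follows by
    letting y tend to infinity in its own increment bound. *)
Lemma exists_exp_limit (f M : R -> R) : (forall x, 0 <= x -> 0 <= f x) ->
  (forall a, 0 <= M a) ->
  (forall a x y, 0 < a < 1 -> 0 <= x -> x <= y ->
    `|f y - f x| <= M a * expR (- (a * x))) ->
  exists2 l : R, 0 <= l & forall a x, 0 < a < 1 -> 0 <= x ->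
    `|f x - l| <= M a * expR (- (a * x)).
Proof.
move=> f0 M0 fM.
have h12 : 0 < (2^-1 : R) < 1 by lra.
pose r x := M 2^-1 * expR (- (2^-1 * x)).
pose A := [set f x - r x | x in [set x | 0 <= x]].
have ub y : 0 <= y -> ubound A (f y + r y).
  move=> y0 _ [x /= x0 <-].
  have rx : 0 <= r x by rewrite mulr_ge0 ?expR_ge0.
  have ry : 0 <= r y by rewrite mulr_ge0 ?expR_ge0.
  have [xy|/ltW yx] := leP x y.
    by have := fM _ _ _ h12 x0 xy; rewrite -/(r x) ler_norml => /andP[]; lra.
  by have := fM _ _ _ h12 y0 yx; rewrite -/(r y) ler_norml => /andP[]; lra.
have hsA : has_sup A.
  split; first by exists (f 0 - r 0), 0 => //=.
  by exists (f 0 + r 0); exact: ub.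
pose l := sup A.
have lr x : 0 <= x -> `|f x - l| <= r x.
  move=> x0; rewrite ler_norml; apply/andP; split.
    have : l <= f x + r x by apply: ge_sup; [exact: hsA.1|exact: ub].
    lra.
  have : f x - r x <= l by apply: ub_le_sup; [exact: hsA.2|exists x].
  lra.
have all a x : 0 < a < 1 -> 0 <= x -> `|f x - l| <= M a * expR (- (a * x)).
  move=> a01 x0; apply/ler_addgt0Pr => e e0.
  have M1 : 0 < M 2^-1 + 1 by rewrite ltr_wpDl.
  have [y0 hy] := @expRN_le 2^-1 (e / (M 2^-1 + 1)) (proj1 (andP h12)) (divr_gt0 e0 M1).
  pose y := Num.max x y0.
  have xy : x <= y by rewrite le_max lexx.
  have h1 := fM a x y a01 x0 xy.
  have h2 := lr y (le_trans x0 xy).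
  have h3 : r y <= e.
    have := hy y; rewrite le_max lexx orbT => /(_ isT) h.
    apply: le_trans (ler_wpM2l (M0 _) h) _.
    rewrite mulrCA -[leRHS]mulr1 ler_wpM2l ?(ltW e0)// ler_pdivrMr// mul1r.
    by rewrite lerDl.
  have -> : f x - l = (f y - l) - (f y - f x) by ring.
  by apply: le_trans (ler_normB _ _) _; rewrite addrC lerD// (le_trans h2).
exists l => //.
rewrite leNgt; apply/negP => l0.
have M1 : 0 < M 2^-1 + 1 by rewrite ltr_wpDl.
have e0 : 0 < - l / 2 by lra.
have [y0 hy] := @expRN_le 2^-1 (- l / 2 / (M 2^-1 + 1)) (proj1 (andP h12)) (divr_gt0 e0 M1).
pose y := Num.max 0 y0.
have y_ge0 : 0 <= y by rewrite le_max lexx.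
have h2 := lr y y_ge0.
have h3 : r y <= - l / 2.
  have := hy y; rewrite le_max lexx orbT => /(_ isT) h.
  apply: le_trans (ler_wpM2l (M0 _) h) _.
  rewrite mulrCA -[leRHS]mulr1 ler_wpM2l ?(ltW e0)// ler_pdivrMr// mul1r.
  by rewrite lerDl.
have := f0 y y_ge0; move: h2; rewrite ler_norml => /andP[]; lra.
Qed.

(* Comparison of e^{x/mu}(u - s) with K e^{(1/mu - a)x} / (1 - mu a), whose
   derivative is K e^{(1/mu - a)x} / mu. *)
Lemma relaxation_incoming (u S : R -> R) (mu a s K : R) :
  half_C1 u (fun x => (S x - u x) / mu) -> 0 < mu -> 0 < 1 - mu * a -> 0 <= K ->
  (forall x, 0 <= x -> `|S x - s| <= K * expR (- (a * x))) ->
  forall x, 0 <= x ->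
    `|u x - s| <= (`|u 0 - s| - K / (1 - mu * a)) * expR (- (x / mu)) +
      K / (1 - mu * a) * expR (- (a * x)).
Proof.
move=> hu mu0 ma0 K0 Ss x x0.
set k := K / (1 - mu * a).
have hw := half_C1M (half_C1_expR mu^-1) (half_C1B hu (half_C1_cst s)).
have hv := half_C1Z k (half_C1_expR (mu^-1 - a)).
have key (sg : R) : `|sg| = 1 ->
    sg * (u x - s) <= (`|u 0 - s| - k) * expR (- (x / mu)) + k * expR (- (a * x)).
  move=> sg1.
  have h := half_C1B (half_C1Z sg hw) hv.
  have : forall z, 0 < z -> sg * (mu^-1 * expR (mu^-1 * z) * (u z - s) +
      expR (mu^-1 * z) * ((S z - u z) / mu - 0)) -
      k * ((mu^-1 - a) * expR ((mu^-1 - a) * z)) <= 0.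
    move=> z z0.
    have -> : (mu^-1 - a) * z = mu^-1 * z + - (a * z) by ring.
    rewrite expRD.
    have -> : sg * (mu^-1 * expR (mu^-1 * z) * (u z - s) +
      expR (mu^-1 * z) * ((S z - u z) / mu - 0)) -
      k * ((mu^-1 - a) * (expR (mu^-1 * z) * expR (- (a * z)))) =
      expR (mu^-1 * z) * mu^-1 * (sg * (S z - s) - K * expR (- (a * z))).
      by rewrite /k; field; rewrite !gt_eqF.
    apply: mulr_ge0_le0; first by rewrite mulr_ge0 ?expR_ge0// invr_ge0 ltW.
    rewrite subr_le0; apply: le_trans (Ss z (ltW z0)).
    by apply: le_trans (ler_norm _) _; rewrite normrM sg1 mul1r.
  move=> /(half_C1_le0 h) /(_ 0 x (lexx 0) x0).
  rewrite !mulr0 !expR0 mul1r mulr1.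
  have -> : (mu^-1 - a) * x = mu^-1 * x + - (a * x) by ring.
  rewrite expRD => h1.
  have h2 : sg * (u 0 - s) <= `|u 0 - s|.
    by apply: le_trans (ler_norm _) _; rewrite normrM sg1 mul1r.
  have h3 : sg * (expR (mu^-1 * x) * (u x - s)) - k * (expR (mu^-1 * x) * expR (- (a * x)))
    <= `|u 0 - s| - k by lra.
  have := ler_wpM2r (expR_ge0 (- (x / mu))) h3.
  have e1 : expR (mu^-1 * x) * expR (- (x / mu)) = 1.
    by rewrite -expRD mulrC subrr expR0.
  have -> : (sg * (expR (mu^-1 * x) * (u x - s)) - k * (expR (mu^-1 * x) * expR (- (a * x)))) *
    expR (- (x / mu)) = (expR (mu^-1 * x) * expR (- (x / mu))) *
     (sg * (u x - s) - k * expR (- (a * x))) by ring.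
  by rewrite e1 mul1r; lra.
rewrite ler_norml; apply/andP; split.
  by rewrite lerNl; have := key (-1); rewrite mulN1r normrN normr1; exact.
by rewrite -[leLHS]mul1r; apply: key; rewrite normr1.
Qed.

(** No value at x = 0 is prescribed when mu < 0; boundedness replaces it. The function k e^{-ax}
    with k = K / (1 - mu a) solves mu v' + v = K e^{-ax} exactly, and its differences with u - s and
    s - u fall under [half_C1_bounded_ge0] at rate 1/mu. *)
Lemma relaxation_outgoing (u S : R -> R) (mu a s K B : R) :
  half_C1 u (fun x => (S x - u x) / mu) -> mu < 0 -> 0 < a -> 0 <= K ->
  (forall x, 0 <= x -> `|u x| <= B) ->
  (forall x, 0 <= x -> `|S x - s| <= K * expR (- (a * x))) ->
  forall x, 0 <= x -> `|u x - s| <= K / (1 - mu * a) * expR (- (a * x)).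
Proof.
move=> hu mu0 a0 K0 uB Ss x x0.
have ma0 : 0 < 1 - mu * a by rewrite subr_gt0 (lt_trans _ ltr01)// nmulr_rlt0.
set k := K / (1 - mu * a).
have k0 : 0 <= k by rewrite divr_ge0// ltW.
have hv := half_C1Z k (half_C1_expR (- a)).
have key (sg : R) : `|sg| = 1 -> sg * (u x - s) <= k * expR (- (a * x)).
  move=> sg1.
  have h := half_C1B hv (half_C1Z sg (half_C1B hu (half_C1_cst s))).
  rewrite -subr_ge0 -mulNr.
  apply: (half_C1_bounded_ge0 h (c := mu^-1) (B := k + B + `|s|)) => //.
  - by rewrite invr_lt0.
  - move=> z z0; apply: le_trans (ler_normB _ _) _; rewrite -addrA lerD//.
      rewrite normrM (ger0_norm k0) ger0_norm ?expR_ge0//.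
      rewrite -[leRHS]mulr1 ler_wpM2l// -expR0 ler_expR mulNr oppr_le0.
      by rewrite mulr_ge0// ltW.
    rewrite normrM sg1 mul1r; apply: le_trans (ler_normB _ _) _.
    by rewrite lerD// uB.
  - move=> z z0; rewrite (_ : - a * z = - (a * z)); last by ring.
    have -> : k * (- a * expR (- (a * z))) - sg * ((S z - u z) / mu - 0) +
      mu^-1 * (k * expR (- (a * z)) - sg * (u z - s)) =
      mu^-1 * (K * expR (- (a * z)) - sg * (S z - s)).
      by rewrite /k; field; rewrite lt_eqF// gt_eqF.
    apply: mulr_le0_ge0; first by rewrite invr_le0 ltW.
    rewrite subr_ge0; apply: le_trans (Ss z (ltW z0)).
    by apply: le_trans (ler_norm _) _; rewrite normrM sg1 mul1r.
rewrite ler_norml; apply/andP; split.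
  by rewrite lerNl; have := key (-1); rewrite mulN1r normrN normr1; exact.
by rewrite -[leLHS]mul1r; apply: key; rewrite normr1.
Qed.

End decay.

(** * Weak formulations *)

Lemma integral_null_diff d (X : measurableType d) (R : realType)
    (m : {measure set X -> \bar R}) (A B : set X) (f : X -> \bar R) :
  measurable A -> measurable B -> B `<=` A -> m (A `\` B) = 0%E ->
  measurable_fun A f -> (\int[m]_(x in A) f x = \int[m]_(x in B) f x)%E.
Proof.
move=> mA mB BA m0 mf.
have mN : measurable (A `\` B) by exact: measurableD.
rewrite integralE [RHS]integralE; congr (_ - _)%E.
- rewrite (ge0_negligible_integral mN)//; last exact: measurable_funepos.
  by rewrite setDD setIidr.
- rewrite (ge0_negligible_integral mN)//; last exact: measurable_funeneg.
  by rewrite setDD setIidr.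
Qed.

Section plane.
Context {R : realType}.
Notation leb := (@lebesgue_measure R).
Notation leb2 := (leb \x leb)%E.

(** The sigma-algebra on the plane is generated by products of measurable sets. An open set is the
    countable union of the boxes it contains with rational centre and radius 1/(n+1); a radius below
    e/2 suffices because the given point need not be the centre. *)
Lemma open_measurable2 (U : set (R * R)) : open U -> measurable U.
Proof.
move=> oU.
pose B (p q : rat) n : set (R * R) :=
  ball (ratr p : R) n.+1%:R^-1 `*` ball (ratr q : R) n.+1%:R^-1.
pose B' p q n := if `[< B p q n `<=` U >] then B p q n else set0.
have -> : U = \bigcup_p \bigcup_q \bigcup_n B' p q n.
  apply/seteqP; split; last first.
    move=> z [p _] [q _] [n _]; rewrite /B'; case: ifPn => // /asboolP; exact.
  move=> [x y] Uxy.
  have /nbhs_ballP[e /= e0 eU] : nbhs (x, y) U by exact: open_nbhs_nbhs.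
  have e20 : 0 < e / 2 by rewrite divr_gt0.
  have [n ne] : exists n : nat, n.+1%:R^-1 < e / 2.
    near \oo => n; exists n; near: n; exact: near_infty_natSinv_lt (PosNum e20).
  have n0 : 0 < n.+1%:R^-1 :> R by rewrite invr_gt0.
  have dens (r t : R) : 0 < r -> exists p : rat, ball (ratr p : R) r t.
    move=> r0; have tt : t - r < t + r by lra.
    have [p] := rat_in_itvoo tt; rewrite in_itv/= => /andP[h1 h2].
    by exists p; rewrite -ball_normE/= ltr_norml; apply/andP; split; lra.
  have tri (r c t t' : R) : r < e / 2 -> ball c r t -> ball c r t' -> ball t e t'.
    rewrite -!ball_normE/= !ltr_norml => re /andP[? ?] /andP[? ?].
    by apply/andP; split; lra.
  have [p bp] := dens _ x n0; have [q bq] := dens _ y n0.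
  exists p => //; exists q => //; exists n => //.
  rewrite /B' ifT//; apply/asboolP => -[x' y'] [/= hx hy]; apply: eU.
  by split; [exact: tri ne bp hx|exact: tri ne bq hy].
apply: bigcupT_measurable_rat => p; apply: bigcupT_measurable_rat => q.
apply: bigcupT_measurable => n; rewrite /B'; case: ifP => // _.
by apply: measurableX; exact: measurable_ball.
Unshelve. all: end_near. Qed.

Lemma continuous_measurable2 (f : R * R -> R) : continuous f -> measurable_fun setT f.
Proof.
move=> cf; apply: (measurability _ (RGenOInfty.measurableE R)).
move=> /= _ [_ [a ->] <-]; rewrite setTI; apply: open_measurable2.
move/continuousP : cf; apply; exact: interval_open.
Qed.

Lemma plane_bounded (f : R * R -> R) (a b c d : R) : continuous f ->
  exists B, forall x y, a <= x <= b -> c <= y <= d -> `|f (x, y)| <= B.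
Proof.
move=> cf.
have cK : compact (`[a, b]%classic `*` `[c, d]%classic).
  by apply: compact_setX; exact: segment_compact.
have /compact_bounded[M [_ hM]] : compact (f @` (`[a, b]%classic `*` `[c, d]%classic)).
  by apply: continuous_compact => //; exact: continuous_subspaceT.
exists (`|M| + 1) => x y xab ycd.
apply: (hM (`|M| + 1)); first by rewrite (le_lt_trans (ler_norm _))// ltrDl.
by exists (x, y) => //; split; rewrite /= in_itv.
Qed.

Lemma derive_x (Phi : R * R -> R) (x mu : R) :
  'D_1 (fun x => Phi (x, mu)) x = dx Phi (x, mu) /\
  (derivable Phi (x, mu) (1, 0) -> derivable (fun x => Phi (x, mu)) x 1).
Proof.
have e : (fun h : R => h^-1 *: (((fun x => Phi (x, mu)) \o shift x) (h *: 1) - Phi (x, mu))) =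
    (fun h : R => h^-1 *: ((Phi \o shift (x, mu)) (h *: (1, 0)) - Phi (x, mu))).
  apply/funext => h; congr (_ *: (_ - _)) => /=.
  congr Phi; rewrite [RHS]surjective_pairing; congr pair.
  by rewrite /= scaler0 add0r.
by split; rewrite /dx /derive /derivable e.
Qed.

Lemma test2_slice (Phi : R * R -> R) (mu : R) : test2_bd Phi ->
  test1_bd (fun x => Phi (x, mu)) /\
  forall x, derive1 (fun x => Phi (x, mu)) x = dx Phi (x, mu).
Proof.
move=> [[cPhi dPhi _ cdx _] [b Phib]].
have E x : derive1 (fun x => Phi (x, mu)) x = dx Phi (x, mu).
  by rewrite derive1E; exact: (derive_x Phi x mu).1.
split=> //; split; last by exists b => x; exact: Phib.
split; first by move=> x; apply: (derive_x Phi x mu).2.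
have -> : derive1 (fun x => Phi (x, mu)) = dx Phi \o (fun x => (x, mu)).
  by apply/funext => x; rewrite E.
move=> x; apply: continuous_comp; last exact: cdx.
exact: (cvg_pair cvg_id (cvg_cst mu)).
Qed.

End plane.

Section phase_space_integrals.
Context {R : realType}.
Notation leb := (@lebesgue_measure R).
Notation leb2 := (leb \x leb)%E.
Variable D : set R.
Hypothesis mD : measurable D.
Hypothesis D_directions : D `<=` directions.
Hypothesis D_full : leb (directions `\` D) = 0%E.

Lemma measurable_directions : measurable (@directions R).
Proof. exact: measurable_itv. Qed.

Lemma measurable_phase_space : measurable (@phase_space R).
Proof. by apply: measurableX; [exact: measurable_half_line|exact: measurable_directions]. Qed.

Lemma phase_space_full (A : set R) : measurable A ->
  leb2 ((A `*` directions) `\` (A `*` D)) = 0%E.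
Proof.
move=> mA.
have -> : (A `*` directions) `\` (A `*` D) = A `*` (directions `\` D).
  apply/seteqP; split => -[x mu] /=; first by move=> [[? ?] h]; split => //; split => // ?; exact: h.
  by move=> [? [? h]]; split => // -[].
rewrite product_measure1E.
- by rewrite [X in (_ * X)%E]D_full mule0.
- exact: mA.
- by apply: measurableD => //; exact: measurable_directions.
Qed.

Lemma integral_directions (f : R -> \bar R) : measurable_fun directions f ->
  (\int[leb]_(mu in directions) f mu = \int[leb]_(mu in D) f mu)%E.
Proof.
by move=> mf; apply: integral_null_diff => //; exact: measurable_directions.
Qed.

Lemma integral_phase_space (A : set R) (f : R * R -> \bar R) : measurable A ->
  measurable_fun (A `*` directions) f ->
  (\int[leb2]_(z in A `*` directions) f z = \int[leb2]_(z in A `*` D) f z)%E.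
Proof.
move=> mA mf; apply: integral_null_diff => //.
- by apply: measurableX => //; exact: measurable_directions.
- exact: measurableX.
- by move=> [x mu] [? /D_directions].
- exact: phase_space_full.
Qed.

Lemma integrable_half_line (g : R -> R) (b M : R) : measurable_fun setT g ->
  (forall x, 0 <= x <= b -> `|g x| <= M) -> (forall x, b <= x -> g x = 0) ->
  leb.-integrable half_line (EFin \o g).
Proof.
move=> mg gM gb.
have mH := measurable_half_line (R := R).
have h : leb.-integrable `[0%R, b] (EFin \o g).
  apply: (@bounded_integrable _ _ _ leb _ _ M) => //.
  - by rewrite /= lebesgue_measure_itv; case: ifP => _; rewrite -?EFinB ltry.
  - exact: measurable_funTS.
apply: (@integrable_mkcond _ _ _ leb _ _ mH).2.
suff -> : (EFin \o g) \_ half_line = (EFin \o g) \_ `[0%R, b].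
  by apply: (@integrable_mkcond _ _ _ leb _ _ (measurable_itv _)).1 h.
apply/funext => x; rewrite !patchE !mem_setE /half_line !in_itv/= andbT.
by case: leP => //= x0; case: leP => //= bx; rewrite gb// ltW.
Qed.

(** The phase space has infinite measure and the intensity is bounded over [D] only; the null set of
    bad directions and the region beyond the support are removed in turn, which leaves a bounded
    function on a set of finite measure. *)
Lemma integrable_phase_space (G : R * R -> R) (b M : R) : measurable_fun setT G ->
  (forall x mu, 0 <= x <= b -> D mu -> `|G (x, mu)| <= M) ->
  (forall x mu, b <= x -> G (x, mu) = 0) ->
  leb2.-integrable phase_space (EFin \o G).
Proof.
move=> mG GM Gb.
have mH := measurable_half_line (R := R).
have mHD : measurable (@half_line R `*` D) by apply: measurableX; [exact: mH|exact: mD].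
have mbD : measurable (`[0%R, b]%classic `*` D).
  by apply: measurableX; [exact: measurable_itv|exact: mD].
have mN : measurable (@phase_space R `\` (@half_line R `*` D)).
  by apply: measurableD => //; exact: measurable_phase_space.
have sub : @half_line R `*` D `<=` phase_space by move=> [x mu] [? /D_directions].
apply: (@negligible_integrable _ _ _ leb2 _ _ _ mN measurable_phase_space _ _).2.
- by apply/measurable_EFinP; exact: measurable_funTS.
- exact: phase_space_full (measurable_half_line (R := R)).
rewrite setDD (setIidr sub).
have fin : (leb2 (`[0%R, b]%classic `*` D) < +oo)%E.
  rewrite product_measure1E; [|exact: measurable_itv|exact: mD].
  rewrite lte_mul_pinfty//; last exact: leb_D_fin.
  by rewrite /= lebesgue_measure_itv; case: ifP => _; rewrite -?EFinB.
have h : leb2.-integrable (`[0%R, b]%classic `*` D) (EFin \o G).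
  apply: (@bounded_integrable _ _ _ leb2 _ _ M) => //.
  - exact: measurable_funTS.
  - by move=> [x mu] [/= + Dmu]; rewrite in_itv/= => xb; exact: GM.
apply: (@integrable_mkcond _ _ _ leb2 _ _ mHD).2.
suff -> : (EFin \o G) \_ (@half_line R `*` D) = (EFin \o G) \_ (`[0%R, b] `*` D).
  by apply: (@integrable_mkcond _ _ _ leb2 _ _ mbD).1 h.
apply/funext => -[x mu]; rewrite !patchE !in_setX/= !mem_setE /half_line !in_itv/= andbT.
case: leP => //= x0; case: leP => //= bx; case: ifP => // _.
by rewrite Gb// ltW.
Qed.

End phase_space_integrals.

Section trace_formula.
Context {R : realType}.
Notation leb := (@lebesgue_measure R).
Notation leb2 := (leb \x leb)%E.
Variables (D : set R) (B : R) (S : R -> R) (psi : R * R -> R).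
Hypothesis mD : measurable D.
Hypothesis D_directions : D `<=` directions.
Hypothesis D_full : leb (directions `\` D) = 0%E.
Hypothesis D_neq0 : forall mu, D mu -> mu != 0.
Hypothesis mpsi : measurable_fun setT psi.
Hypothesis cS : continuous S.
Hypothesis S_le : forall x, `|S x| <= B.
Hypothesis psi_le : forall x mu, D mu -> `|psi (x, mu)| <= B.
Hypothesis hpsi : forall mu, D mu ->
  half_C1 (fun x => psi (x, mu)) (fun x => (S x - psi (x, mu)) / mu).
Let B_ge0 : 0 <= B. Proof. by apply: le_trans (S_le 0); exact: normr_ge0. Qed.

Variable Phi : R * R -> R.
Hypothesis tPhi : test2_bd Phi.

Let mPhi : measurable_fun setT Phi.
Proof. by apply: continuous_measurable2; case: tPhi => -[]. Qed.

Let mdxPhi : measurable_fun setT (dx Phi).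
Proof. by apply: continuous_measurable2; case: tPhi => -[]. Qed.

Lemma test2_bounds : exists b M, [/\ 0 <= b, 0 <= M,
  forall x mu, b <= x -> Phi (x, mu) = 0 /\ dx Phi (x, mu) = 0 &
  forall x mu, 0 <= x <= b -> directions mu ->
    `|Phi (x, mu)| <= M /\ `|dx Phi (x, mu)| <= M].
Proof.
have [[cPhi _ _ cdx _] [b0 Phib]] := tPhi.
pose b := Num.max b0 0 + 1.
have b_ge0 : 0 <= b by rewrite addr_ge0// le_max lexx orbT.
have b0b : b0 < b by rewrite /b ltr_pwDr// le_max lexx.
have [M1 h1] := plane_bounded 0 b (-1) 1 cPhi.
have [M2 h2] := plane_bounded 0 b (-1) 1 cdx.
exists b, (Num.max `|M1| `|M2|); split => //.
- move=> x mu bx; have b0x : b0 < x by exact: lt_le_trans bx.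
  split; first by apply: Phib; exact: ltW.
  have [_ <-] := test2_slice mu tPhi.
  by apply: (derive1_eq0_beyond _ b0x) => y; exact: Phib.
- move=> x mu xb; rewrite /directions/= in_itv/= => mu1; split.
    by rewrite (le_trans (h1 _ _ xb mu1))// le_max; apply/orP; left; exact: ler_norm.
  by rewrite (le_trans (h2 _ _ xb mu1))// le_max; apply/orP; right; exact: ler_norm.
Qed.

Let flux z := z.2 * psi z * dx Phi z.
Let loss z := (S z.1 - psi z) * Phi z.

Let mflux : measurable_fun setT flux.
Proof.
apply: measurable_funM => //; apply: measurable_funM => //.
Qed.

Let mloss : measurable_fun setT loss.
Proof.
apply: measurable_funM => //; apply: measurable_funB => //.
by apply: measurableT_comp measurable_fst; exact: continuous_measurable_fun.
Qed.

Let bounds : exists b M, [/\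
  forall x mu, b <= x -> flux (x, mu) = 0 /\ loss (x, mu) = 0 &
  forall x mu, 0 <= x <= b -> D mu ->
    `|flux (x, mu)| <= M /\ `|loss (x, mu)| <= M].
Proof.
have [b [M [b0 M0 zero le]]] := test2_bounds.
exists b, (2 * B * M); split.
  by move=> x mu /(zero _ mu)[h1 h2]; rewrite /flux /loss h1 h2 !mulr0.
move=> x mu xb Dmu; have [h1 h2] := le x mu xb (D_directions Dmu).
have mu1 : `|mu| <= 1.
  by move: (D_directions Dmu); rewrite /directions/= in_itv/= ler_norml.
have pB := psi_le x Dmu; split.
  rewrite /flux/= !normrM; apply: ler_pM => //.
  apply: (@le_trans _ _ (1 * B)); first exact: ler_pM.
  by rewrite ler_wpM2r// ler1n.
rewrite /loss/= normrM; apply: ler_pM => //.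
apply: le_trans (ler_normB _ _) _; have := S_le x; lra.
Qed.

Lemma integrable_flux : leb2.-integrable phase_space (EFin \o flux).
Proof.
have [b [M [zero le]]] := bounds.
apply: (@integrable_phase_space _ D _ _ _ _ b M) => //.
- by move=> x mu xb /(le x mu xb)[].
- by move=> x mu /(zero _ mu)[].
Qed.

Lemma integrable_loss : leb2.-integrable phase_space (EFin \o loss).
Proof.
have [b [M [zero le]]] := bounds.
apply: (@integrable_phase_space _ D _ _ _ _ b M) => //.
- by move=> x mu xb /(le x mu xb)[].
- by move=> x mu /(zero _ mu)[].
Qed.

(** Fubini with mu outermost: for each mu in [D] the inner integral is Green's formula for mu psi(.,
    mu), whose derivative is S - psi. As no derivative in mu occurs, nothing is produced at mu = -1
    and mu = 1. *)
Lemma trace_formula :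
  \int[leb2]_(z in phase_space) (flux z + loss z) =
  - \int[leb]_(mu in directions) (mu * psi (0, mu) * Phi (0, mu)).
Proof.
pose G z := flux z + loss z.
have mG : measurable_fun setT G by exact: measurable_funD.
have intG : leb2.-integrable phase_space (EFin \o G).
  have := @integrableD _ _ _ leb2 _ measurable_phase_space _ _ integrable_flux integrable_loss.
  exact.
have intG' : leb2.-integrable setT ((EFin \o G) \_ phase_space).
  by apply: (@integrable_mkcond _ _ _ leb2 _ _ measurable_phase_space).1 intG.
pose q mu := mu * psi (0, mu) * Phi (0, mu).
have mq : measurable_fun setT q.
  have m1 : measurable_fun setT (fun mu => Phi (0, mu)) by exact: measurable_fun_pair2 mPhi.
  have m2 : measurable_fun setT (fun mu => psi (0, mu)) by exact: measurable_fun_pair2 mpsi.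
  by apply: measurable_funM => //; exact: measurable_funM.
have inner mu : D mu -> (\int[leb]_(x in half_line) (G (x, mu))%:E = (- q mu)%:E)%E.
  move=> Dmu; have [b [M [zero le]]] := bounds.
  have int1 : leb.-integrable half_line (EFin \o (fun x => G (x, mu))).
    apply: (@integrable_half_line _ _ b (M + M)).
    - exact: (measurableT_comp mG (pair2_measurable mu)).
    - move=> x /(le x mu)/(_ Dmu)[h1 h2]; apply: le_trans (ler_normD _ _) _.
      exact: lerD.
    - by move=> x /(zero x mu)[h1 h2]; rewrite /G h1 h2 addr0.
  rewrite -[LHS]fineK; last by apply: integrable_fin_num => //; exact: measurable_half_line.
  congr EFin.
  have [tphi dphi] := test2_slice mu tPhi.
  have := green_half_line (half_C1Z mu (hpsi Dmu)) tphi.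
  rewrite -/(q mu) => <-; apply: eq_Rintegral => x _.
  rewrite dphi /G /flux /loss/=; congr (_ + _ * _).
  by field; exact: D_neq0.
have fubini : (\int[leb2]_(z in phase_space) (G z)%:E =
    \int[leb]_(mu in D) (- q mu)%:E)%E.
  rewrite integral_mkcond -(integral21_prod_meas1 intG').
  transitivity (\int[leb]_(mu in directions)
     fubini_G leb ((EFin \o G) \_ phase_space) mu)%E.
    rewrite [RHS]integral_mkcond; apply: eq_integral => mu _.
    rewrite patchE; case: ifPn => // mun; rewrite /fubini_G integral0_eq// => x _.
    by rewrite patchE /phase_space in_setX (negbTE mun) andbF.
  rewrite (integral_directions mD D_directions D_full); last first.
    by apply: measurable_funTS; exact: measurable_fubini_G intG'.
  apply: eq_integral => mu; rewrite inE => Dmu.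
  rewrite -(inner mu Dmu) /fubini_G [RHS]integral_mkcond; apply: eq_integral => x _.
  rewrite !patchE /phase_space in_setX (_ : mu \in directions) ?andbT//.
  by rewrite inE; exact: D_directions.
have [b [M [b0 M0 _ le]]] := test2_bounds.
have intq : leb.-integrable D (EFin \o q).
  apply: (@bounded_integrable _ _ _ leb _ _ (1 * B * M)) => //.
  - exact: leb_D_fin.
  - exact: measurable_funTS.
  - move=> mu Dmu; rewrite !normrM.
    have [h1 _] : `|Phi (0, mu)| <= M /\ `|dx Phi (0, mu)| <= M.
      by apply: le (D_directions Dmu); rewrite lexx.
    do 2 (apply: ler_pM => //); last exact: psi_le.
    by move: (D_directions Dmu); rewrite /directions/= in_itv/= ler_norml.
rewrite [LHS]/Rintegral fubini.
rewrite [in RHS]/Rintegral (integral_directions mD D_directions D_full); last first.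
  by apply/measurable_EFinP; exact: measurable_funTS.
transitivity (\int[leb]_(mu in D) (-1 * q mu)).
  by apply: eq_Rintegral => mu _; rewrite mulN1r.
by rewrite RintegralZl// mulN1r.
Qed.

End trace_formula.

Section test_functions.
Context {R : realType}.
Notation leb := (@lebesgue_measure R).

Lemma test1_test1_bd (phi : R -> R) : test1 phi -> test1_bd phi /\ phi 0 = 0.
Proof.
move=> [c1 [a [b [a0 phiab]]]]; split.
  (* The support condition allows a nonzero value at [b] itself, whereas [test1_bd] asks the
     function to vanish from the bound onwards. *)
  split=> //; exists (b + 1) => x bx; apply: phiab => /andP[_ xb].
  by have := le_trans bx xb; rewrite gerDl ler10.
by apply: phiab => /andP[ha _]; have := lt_le_trans a0 ha; rewrite ltxx.
Qed.

Lemma test2_test2_bd (Phi : R * R -> R) : test2 Phi ->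
  test2_bd Phi /\ forall mu, Phi (0, mu) = 0.
Proof.
move=> [c1 [a [b [a0 phiab]]]]; split.
  split=> //; exists (b + 1) => x mu bx; apply: phiab => /andP[_ xb].
  by have := le_trans bx xb; rewrite gerDl ler10.
by move=> mu; apply: phiab => /andP[ha _]; have := lt_le_trans a0 ha; rewrite ltxx.
Qed.

Lemma continuous_integrable_half_line (g : R -> R) (b : R) : continuous g ->
  (forall x, b <= x -> g x = 0) -> leb.-integrable half_line (EFin \o g).
Proof.
move=> cg gb.
have /compact_bounded[M [_ hM]] : compact (g @` `[0%R, b]).
  by apply: continuous_compact; [exact: continuous_subspaceT|exact: segment_compact].
apply: (@integrable_half_line _ _ b (`|M| + 1)) => //.
  exact: continuous_measurable_fun.
move=> x xb; apply: (hM (`|M| + 1)); first by rewrite (le_lt_trans (ler_norm _))// ltrDl.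
by exists x => //; rewrite /= in_itv.
Qed.

Lemma green_integrable (u d phi : R -> R) : half_C1 u d -> test1_bd phi ->
  leb.-integrable half_line (EFin \o (fun x => u x * derive1 phi x)) /\
  leb.-integrable half_line (EFin \o (fun x => d x * phi x)).
Proof.
move=> [cu cd _] [[dphi cphi'] [b phib]].
have cphi : continuous phi.
  by move=> x; apply: differentiable_continuous; exact/derivable1_diffP.
split; apply: (@continuous_integrable_half_line _ (b + 1)).
- by move=> x; apply: cvgM; [exact: cu|exact: cphi'].
- move=> x bx; rewrite (derive1_eq0_beyond phib) ?mulr0//.
  by rewrite (lt_le_trans _ bx)// ltrDl.
- by move=> x; apply: cvgM; [exact: cd|exact: cphi].
- by move=> x bx; rewrite phib ?mulr0// (le_trans _ bx)// lerDl.
Qed.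

Lemma green_test1 (u d phi : R -> R) : half_C1 u d -> test1 phi ->
  \int[leb]_(x in half_line) (u x * derive1 phi x) =
  - \int[leb]_(x in half_line) (d x * phi x).
Proof.
move=> hu /test1_test1_bd[tphi phi0].
have [i1 i2] := green_integrable hu tphi.
have := green_half_line hu tphi; rewrite phi0 mulr0 oppr0.
rewrite RintegralD//; last exact: measurable_half_line.
by move/eqP; rewrite addr_eq0 => /eqP.
Qed.

End test_functions.

(** * The mild solution: weak equations, energy estimate and decay *)

Section solution.
Context {R : realType}.
Notation leb := (@lebesgue_measure R).
Notation leb2 := (leb \x leb)%E.
Variables (Tb C : R) (psib pb : R -> R) (D : set R) (T dT : R -> R).
Hypothesis Tb_ge0 : 0 <= Tb.
Hypothesis mpb : measurable_fun setT pb.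
Hypothesis pb_ge0 : forall mu, 0 <= pb mu.
Hypothesis pb_neg : forall mu, mu <= 0 -> pb mu = 0.
Hypothesis pbE : forall mu, 0 < mu <= 1 -> pb mu = psib mu.
Hypothesis mD : measurable D.
Hypothesis D_directions : D `<=` directions.
Hypothesis D_full : leb (directions `\` D) = 0%E.
Hypothesis D_neq0 : forall mu, D mu -> mu != 0.
Hypothesis D_le : forall mu, D mu -> pb mu <= C ^+ 4.
Hypothesis bT : bmf C T.
Hypothesis T0 : T 0 = Tb.
Let S x := T x ^+ 4.
Hypothesis hT : half_C1 T dT.
Hypothesis hdT : half_C1 dT (fun x => \int[leb]_(mu in D) (S x - rad pb S x mu)).

Let psi (z : R * R) := rad pb S z.1 z.2.

Let bS : bmf (C ^+ 4) S. Proof. exact: bmfX4. Qed.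
Let S_ge0 s : 0 <= S s. Proof. exact: bmf_nonneg bS s. Qed.
Let T_ge0 s : 0 <= T s. Proof. exact: bmf_nonneg bT s. Qed.
Let S_le x : `|S x| <= C ^+ 4.
Proof. by rewrite ger0_norm//; have /andP[] := bS.2 x. Qed.
Let C_ge0 : 0 <= C. Proof. exact: bmf_ge0 bT. Qed.

Let cT : continuous T. Proof. by have [] := hT. Qed.
Let cdT : continuous dT. Proof. by have [] := hdT. Qed.
Let cS : continuous S.
Proof. by have [h _ _] := half_C1X 3 hT; exact: h. Qed.

Let psi_ge0 x mu : 0 <= rad pb S x mu.
Proof. exact: rad_ge0. Qed.

Let psi_bounds x mu : D mu -> 0 <= rad pb S x mu <= C ^+ 4.
Proof. by move=> Dmu; rewrite psi_ge0 (rad_le pb_neg D_neq0 D_le). Qed.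

Let psi_le x mu : D mu -> `|psi (x, mu)| <= C ^+ 4.
Proof. by move=> /(psi_bounds x)/andP[p0 pC]; rewrite ger0_norm. Qed.

Let hpsi mu : mu != 0 -> half_C1 (rad pb S ^~ mu) (fun x => (S x - rad pb S x mu) / mu).
Proof. by move=> mu0; exact: half_C1_rad mu0 bS cS. Qed.

Let hpsiD mu : D mu -> half_C1 (rad pb S ^~ mu) (fun x => (S x - rad pb S x mu) / mu).
Proof. by move=> /D_neq0; exact: hpsi. Qed.

Let mpsi : measurable_fun setT psi.
Proof. by apply: measurable_rad => //; case: bS. Qed.

Let mpsi1 x : measurable_fun setT (rad pb S x).
Proof. by apply: measurable_rad1 => //; case: bS. Qed.

Let mpsiD x : measurable_fun D (rad pb S x).
Proof. exact: measurable_funTS. Qed.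

Let psi0 mu : 0 < mu <= 1 -> psi (0, mu) = psib mu.
Proof.
move=> mu01; rewrite /psi /rad/= maxxx mul0r oppr0 expR0 mulr1 pbE//.
by have /andP[mu0 _] := mu01; rewrite (sweep0 mu0 bS) addr0.
Qed.

Lemma average_absorption x :
  average (fun mu => psi (x, mu) - T x ^+ 4) =
  - \int[leb]_(mu in D) (S x - rad pb S x mu).
Proof.
rewrite /average /Rintegral (integral_directions mD D_directions D_full); last first.
  apply/measurable_EFinP; apply: measurable_funTS; apply: measurable_funB; [exact: mpsi1|exact: measurable_cst].
transitivity (\int[leb]_(mu in D) (-1 * (S x - rad pb S x mu))).
  by apply: eq_Rintegral => mu _; rewrite mulN1r opprB.
rewrite RintegralZl ?mulN1r//.
apply: (@bounded_integrable _ _ _ leb _ _ (C ^+ 4)) => //.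
- exact: leb_D_fin.
- by apply: measurable_funB; [exact: measurable_cst|exact: mpsiD].
- move=> mu Dmu; have /andP[p0 pC] := psi_bounds x Dmu.
  have := S_le x; rewrite ger0_norm// => sC; have := S_ge0 x => s0.
  by rewrite ler_norml; apply/andP; split; lra.
Qed.

Lemma solves_milne : milne_solution Tb psib T dT psi.
Proof.
split.
- split.
  + split; first by apply: measurable_funTS; case: bT.
    move=> b; apply: integrable_lty; first exact: measurable_itv.
    apply: (@continuous_compact_integrable _ (fun x => T x ^+ 2)).
      exact: segment_compact.
    by apply: continuous_subspaceT; have [h _ _] := half_C1X 1 hT.
  + split; first by apply: measurable_funTS; exact: continuous_measurable_fun.
    move=> b; apply: integrable_lty; first exact: measurable_itv.
    apply: (@continuous_compact_integrable _ (fun x => dT x ^+ 2)).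
      exact: segment_compact.
    by apply: continuous_subspaceT; have [h _ _] := half_C1X 1 hdT.
  + split; first exact: measurable_funTS.
    move=> b; rewrite (integral_phase_space mD D_directions D_full); last 2 first.
    * exact: measurable_itv.
    * by apply/measurable_EFinP; apply: measurable_funTS; exact: measurable_funX.
    have mbD : measurable (`[0%R, b]%classic `*` D).
      by apply: measurableX; [exact: measurable_itv|exact: mD].
    apply: (@integrable_lty _ _ _ leb2 _ mbD).
    have fin : (leb2 (`[0%R, b]%classic `*` D) < +oo)%E.
      rewrite product_measure1E; [|exact: measurable_itv|exact: mD].
      rewrite lte_mul_pinfty//; last exact: leb_D_fin.
      by rewrite /= lebesgue_measure_itv; case: ifP => _; rewrite -?EFinB.
    apply: (@bounded_integrable _ _ _ leb2 _ _ ((C ^+ 4) ^+ 2)) => //.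
    * by apply: measurable_funTS; exact: measurable_funX.
    * by move=> [x mu] [_ /= Dmu]; rewrite normrX lerXn2r ?nnegrE ?exprn_ge0// psi_le.
  + split; first exact: continuous_subspaceT.
    by move=> mu _ mu0; apply: continuous_subspaceT; have [] := hpsi mu0.
- by move=> phi; exact: green_test1.
- move=> phi tphi; rewrite (green_test1 hdT tphi).
  transitivity (\int[leb]_(x in half_line)
    (-1 * (\int[leb]_(mu in D) (S x - rad pb S x mu) * phi x))).
    rewrite RintegralZl ?mulN1r//; first exact: measurable_half_line.
    by have [t _] := test1_test1_bd tphi; have [] := green_integrable hdT t.
  by apply: eq_Rintegral => x _; rewrite average_absorption mulN1r mulNr.
(* The weak equation is the trace formula for a test function vanishing at x = 0: the boundary term
   disappears and the two integrals separate. *)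
- move=> Phi /test2_test2_bd[tPhi Phi0].
  have := trace_formula mD D_directions D_full D_neq0 mpsi cS S_le psi_le hpsiD tPhi.
  rewrite RintegralD; [|exact: measurable_phase_space| |]; last 2 first.
  + exact: (integrable_flux mD D_directions D_full mpsi S_le psi_le tPhi).
  + exact: (integrable_loss mD D_directions D_full mpsi cS S_le psi_le tPhi).
  rewrite [X in _ = - X -> _](_ : _ = 0).
    by move/eqP; rewrite oppr0 addr_eq0 => /eqP.
  by rewrite (@eq_Rintegral _ _ _ _ _ (cst 0)) ?Rintegral_cst ?mul0r// => [|mu _];
    [exact: measurable_directions|rewrite Phi0 mulr0].
- split => //.
  + by move=> phi; exact: green_half_line.
  + split.
    * by apply: measurable_funTS; exact: (mpsi1 0).
    * rewrite (integral_directions mD D_directions D_full); last first.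
        apply/measurable_EFinP; apply: measurable_funTS.
        apply: measurable_funM; first exact: normr_measurable.
        by apply: measurable_funX; exact: mpsi1.
      apply: (@integrable_lty _ _ _ leb _ mD).
      apply: (@bounded_integrable _ _ _ leb _ _ (1 * (C ^+ 4) ^+ 2)) => //.
      - exact: leb_D_fin.
      - apply: measurable_funTS.
        apply: measurable_funM; first exact: normr_measurable.
        by apply: measurable_funX; exact: mpsi1.
      - move=> mu Dmu; rewrite normrM normr_id; apply: ler_pM => //.
          by move: (D_directions Dmu); rewrite /directions/= in_itv/= ler_norml.
        by rewrite normrX lerXn2r ?nnegrE ?exprn_ge0// psi_le.
    * move=> Phi tPhi.
      exact: (trace_formula mD D_directions D_full D_neq0 mpsi cS S_le psi_le hpsiD tPhi).
Qed.

Lemma solution_bounded_nonneg : bounded_nonneg T psi.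
Proof.
split.
- by move=> x _.
- by move=> [x mu] _; exact: psi_ge0.
- by exists C => x _; have /andP[] := bT.2 x.
- exists (C ^+ 4); exists ((half_line `*` directions) `\` (half_line `*` D)); split.
  + apply: measurableD; first exact: measurable_phase_space.
    by apply: measurableX; [exact: measurable_half_line|exact: mD].
  + exact: (phase_space_full mD D_full (measurable_half_line (R := R))).
  + move=> [x mu] /= /not_implyP[pz psiC]; split => // -[_ /= Dmu].
    by apply: psiC; have /andP[] := psi_bounds x Dmu.
Qed.

Let energyE := energy T (rad pb S) D.

(** Cutting [-1, 1] at 0 writes 2 E(0) as incoming energy minus outgoing energy. Solved for the
    outgoing part, it reduces the energy estimate to [weighted_dissipation_integral], and
    nonnegativity of that part gives [energy0_le]. *)
Lemma energy_boundary :
  (\int[leb]_(mu in `[(-1)%R, 0%R]) (`|mu| * (psi (0%R, mu) - Tb ^+ 4) ^+ 2)%:E =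
    (boundary_energy Tb psib - 2 * energyE 0)%:E)%E.
Proof.
pose f mu := mu * (psi (0, mu) - Tb ^+ 4) ^+ 2.
have mf : measurable_fun setT f.
  apply: measurable_funM => //; apply: measurable_funX; apply: measurable_funB; [exact: mpsi1|exact: measurable_cst].
have mdir := measurable_directions (R := R).
have mN : measurable (directions `\` D) by exact: measurableD.
have intf : leb.-integrable directions (EFin \o f).
  apply: (@negligible_integrable _ _ _ leb _ _ _ mN mdir _ D_full).2.
    by apply/measurable_EFinP; exact: measurable_funTS.
  rewrite setDD setIidr//.
  apply: (@bounded_integrable _ _ _ leb _ _ (1 * (C ^+ 4 + Tb ^+ 4) ^+ 2)) => //.
  - exact: leb_D_fin.
  - exact: measurable_funTS.
  - move=> mu Dmu; rewrite /f normrM; apply: ler_pM => //.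
      by move: (D_directions Dmu); rewrite /directions/= in_itv/= ler_norml.
    rewrite normrX lerXn2r ?nnegrE ?addr_ge0 ?exprn_ge0//.
    apply: le_trans (ler_normB _ _) _; rewrite lerD ?psi_le//.
    by rewrite ger0_norm// exprn_ge0.
have dirE : directions = `[-1, 0] `|` `]0, 1] :> set R.
  apply/seteqP; split => mu; rewrite /directions/= !in_itv/=.
    move=> /andP[h1 h2]; have [h|h] := leP mu 0; [left|right]; exact/andP.
  by move=> [/andP[h1 h2]|/andP[h1 h2]]; apply/andP; split => //; lra.
have intN : leb.-integrable `[(-1)%R, 0%R] (EFin \o f).
  by apply: integrableS intf => // mu; rewrite dirE; left.
have E2 : 2 * energyE 0 = \int[leb]_(mu in directions) f mu.
  rewrite /energyE /energy mulrA divff// mul1r /av.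
  rewrite [RHS]/Rintegral (integral_directions mD D_directions D_full); last first.
    by apply/measurable_EFinP; exact: measurable_funTS.
  by rewrite /f -T0.
have E3 : \int[leb]_(mu in directions) f mu =
    \int[leb]_(mu in `[-1, 0]) f mu + boundary_energy Tb psib.
  rewrite dirE Rintegral_setU//; last 2 first.
  + by rewrite -dirE.
  + apply/eqP; rewrite -subset0 => mu [] /=; rewrite !in_itv/= => /andP[_ h] /andP[h' _].
    by have := lt_le_trans h' h; rewrite ltxx.
  congr (_ + _); apply: eq_Rintegral => mu; rewrite inE/= in_itv/= => mu01.
  by rewrite /f psi0.
rewrite E2 E3 opprD addrCA subrr addr0.
rewrite EFinN fineK; last exact: integrable_fin_num intN.
rewrite -integralN; last first.
  by apply: integrable_add_def.
apply: eq_integral => mu; rewrite inE/= in_itv/= => /andP[_ mu0].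
by rewrite /f ler0_norm// mulNr EFinN.
Qed.

Lemma energy0_le : energyE 0 <= boundary_energy Tb psib / 2.
Proof.
have : (0 <= (boundary_energy Tb psib - 2 * energyE 0)%:E)%E.
  rewrite -energy_boundary; apply: integral_ge0 => mu _.
  by rewrite lee_fin mulr_ge0// sqr_ge0.
by rewrite lee_fin; lra.
Qed.

Lemma solution_energy_estimate (alpha : R) : 0 <= alpha < 1 ->
  energy_estimate Tb psib T dT psi alpha.
Proof.
move=> a01; rewrite /energy_estimate energy_boundary.
have inner x : (\int[leb]_(mu in directions)
    (expR (2 * alpha * x) * (psi (x, mu) - T x ^+ 4) ^+ 2)%:E =
    (expR (2 * alpha * x) * dissipation T (rad pb S) D x)%:E)%E.
  rewrite (integral_directions mD D_directions D_full); last first.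
    apply/measurable_EFinP; apply: measurable_funTS; apply: measurable_funM => //.
    by apply: measurable_funX; apply: measurable_funB; [exact: mpsi1|exact: measurable_cst].
  have bd1 : bd D (fun mu => (psi (x, mu) - T x ^+ 4) ^+ 2).
    apply: bdX; apply: bdB; last exact: bd_cst.
    by split; [exact: mpsiD|exists (C ^+ 4) => mu; exact: psi_le].
  rewrite /dissipation -avZ//.
  rewrite -[LHS]fineK//; apply: integrable_fin_num => //.
  by apply: bd_integrable => //; apply: bdM => //; exact: bd_cst.
under [X in (_ + _ * X + _ <= _)%E]eq_integral do rewrite inner.
have := weighted_dissipation_integral mD D_directions D_full D_neq0 bT hT hdT hpsiD
  mpsiD psi_bounds a01.
move=> h; apply: le_trans (leeD2r _ h) _.
rewrite -EFinM -EFinD lee_fin -/energyE; lra.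
Qed.

Lemma decay_const_ge0 (a : R) : 0 <= decay_const Tb psib a.
Proof. by rewrite mulr_ge0 ?invr_ge0// sqrtr_ge0. Qed.

Lemma temperature_decay (a x y : R) : 0 < a < 1 -> 0 <= x -> x <= y ->
  `|T y - T x| <= decay_const Tb psib a * expR (- (a * x)).
Proof.
move=> a01 x0 xy; have /andP[a0 a1] := a01.
have a1' : 0 < 1 - a by rewrite subr_gt0.
have b0 : 0 <= boundary_energy Tb psib.
  apply: Rintegral_ge0 => mu; rewrite /incoming/= in_itv/= => /andP[mu0 _].
  by rewrite mulr_ge0 ?sqr_ge0// ltW.
(* These are the coefficients of [temperature_increment] after bounding E(0) by half the incoming
   energy; four times their product is the square of M_a e^{-ax}. *)
apply: (@young_optimum _ _ (expR (- 2 * a * x) / (6 * a))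
  (boundary_energy Tb psib / (4 * (1 - a)))).
- by rewrite divr_gt0 ?expR_gt0// mulr_gt0.
- by rewrite mulr_ge0 ?expR_ge0 ?decay_const_ge0.
- rewrite /decay_const exprMn exprMn exprVn !sqr_sqrtr//; last first.
    by rewrite !mulr_ge0// ltW.
  rewrite expr2 -expRD (_ : - (a * x) + - (a * x) = - 2 * a * x); last by ring.
  by field; rewrite !gt_eqF.
- move=> lam lam0.
  apply: le_trans (temperature_increment mD D_directions D_full D_neq0 bT hT hdT hpsiD
    mpsiD psi_bounds a01 lam0 x0 xy) _.
  rewrite lerD2l ler_wpM2r ?invr_ge0 ?(ltW lam0)//.
  have -> : boundary_energy Tb psib / (4 * (1 - a)) =
    boundary_energy Tb psib / 2 / (2 * (1 - a)) by field; rewrite gt_eqF.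
  by rewrite ler_wpM2r ?energy0_le// invr_ge0 mulr_ge0// ltW.
Qed.

Lemma solution_decay : exists Tinf : R, 0 <= Tinf /\
  forall alpha : R, 0 < alpha < 1 ->
    let M := decay_const Tb psib alpha in
    [/\ forall x : R, 0 <= x -> `|T x - Tinf| <= M * expR (- (alpha * x)),
        forall x mu : R, 0 <= x -> 0 < mu <= 1 ->
          `|psi (x, mu) - Tinf ^+ 4| <=
            `|psib mu - Tb ^+ 4| * expR (- (x / mu)) +
            4 * (Tb + 2 * M) ^+ 3 * M * (1 - mu * alpha)^-1 * expR (- (alpha * x)),
        forall x mu : R, 0 <= x -> -1 <= mu < 0 ->
          `|psi (x, mu) - Tinf ^+ 4| <=
            4 * (Tb + 2 * M) ^+ 3 * M * (1 - mu * alpha)^-1 * expR (- (alpha * x)),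
        Tinf <= Tb + M
      & forall x : R, 0 <= x -> `|T x| <= Tb + 2 * M].
Proof.
have [Tinf Tinf0 Tdecay] := @exists_exp_limit _ T (decay_const Tb psib)
  (fun x _ => T_ge0 x) decay_const_ge0 temperature_decay.
exists Tinf; split => // alpha a01 M; have /andP[a0 a1] := a01.
have M0 : 0 <= M by exact: decay_const_ge0.
have decay x : 0 <= x -> `|T x - Tinf| <= M * expR (- (alpha * x)).
  by move=> x0; exact: Tdecay.
have TM x : 0 <= x -> `|T x - Tinf| <= M.
  move=> x0; apply: le_trans (decay x x0) _; rewrite -[leRHS]mulr1 ler_wpM2l//.
  by rewrite -expR0 ler_expR oppr_le0 mulr_ge0// ltW.
have TinfM : Tinf <= Tb + M.
  by have := TM 0 (lexx _); rewrite T0 ler_norml => /andP[]; lra.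
have Tx x : 0 <= x -> `|T x| <= Tb + 2 * M.
  move=> x0; rewrite ger0_norm//.
  by have := TM x x0; rewrite ler_norml => /andP[]; lra.
pose K := 4 * (Tb + 2 * M) ^+ 3 * M.
have TM0 : 0 <= Tb + 2 * M by rewrite addr_ge0// mulr_ge0.
have TM30 : 0 <= 4 * (Tb + 2 * M) ^+ 3 by rewrite mulr_ge0// exprn_ge0.
have K0 : 0 <= K by exact: mulr_ge0.
(* Both T x and the limit lie in [0, Tb + 2 M], where the fourth power is Lipschitz with constant 4
   (Tb + 2 M)^3. The bound C of the construction does not enter. *)
have Sdecay x : 0 <= x -> `|S x - Tinf ^+ 4| <= K * expR (- (alpha * x)).
  move=> x0; apply: (@le_trans _ _ (4 * (Tb + 2 * M) ^+ 3 * `|T x - Tinf|)).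
    apply: quartic_dist; last by rewrite T_ge0/= (le_trans (ler_norm _))// Tx.
    by rewrite Tinf0/=; lra.
  by rewrite /K -[leRHS]mulrA ler_wpM2l ?decay.
split => //.
- move=> x mu x0 mu01; have /andP[mu0 mu1] := mu01.
  have ma : 0 < 1 - mu * alpha.
    by rewrite subr_gt0 (le_lt_trans _ a1)// -[leRHS]mul1r ler_wpM2r// ltW.
  have := relaxation_incoming (hpsi (lt0r_neq0 mu0)) mu0 ma K0 Sdecay x0.
  rewrite -/(psi (x, mu)) -/(psi (0, mu)) psi0// -/K.
  move=> h; apply: le_trans h _; rewrite lerD2r ler_wpM2r ?expR_ge0//.
  (* The comparison starts from the distance to Tinf^4 and subtracts K / (1 - mu alpha). That
     negative term is at least K in size, which pays for replacing Tinf^4 by Tb^4. *)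
  have h1 : `|psib mu - Tinf ^+ 4| <= `|psib mu - Tb ^+ 4| + K.
    have -> : psib mu - Tinf ^+ 4 = (psib mu - Tb ^+ 4) + (S 0 - Tinf ^+ 4).
      by rewrite /S T0; ring.
    apply: le_trans (ler_normD _ _) _; rewrite lerD2l.
    by have := Sdecay 0 (lexx _); rewrite mulr0 oppr0 expR0 mulr1.
  have h2 : K <= K / (1 - mu * alpha).
    rewrite ler_pdivlMr// -[leRHS]mulr1 ler_wpM2l// gerBl.
    by rewrite mulr_ge0// ltW.
  lra.
- move=> x mu x0 /andP[mu1 mu0].
  apply: (relaxation_outgoing (B := C ^+ 4) (hpsi (ltr0_neq0 mu0)) mu0 a0 K0) => //.
  (* For mu < 0 the intensity is the sweep alone, so it is bounded by C^4 for every such mu, whether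
     or not it belongs to [D]. *)
  move=> y y0; rewrite ger0_norm// /rad (pb_neg (ltW mu0)) mul0r add0r.
  exact: (sweep_leC _ bS (ltr0_neq0 mu0)).
Qed.

End solution.

Theorem theorem1 (R : realType) (Tb : R) (psib : R -> R)
  (Tb_ge0 : 0 <= Tb)
  (psib_meas : measurable_fun incoming psib)
  (psib_ge0 : forall mu : R, 0 < mu <= 1 -> 0 <= psib mu)
  (psib_bounded : exists C : R,
     {ae @lebesgue_measure R, forall mu : R, 0 < mu <= 1 -> psib mu <= C}) :
  exists (T dT : R -> R) (psi : R * R -> R),
    [/\ milne_solution Tb psib T dT psi,
        bounded_nonneg T psi,
        forall alpha : R, 0 <= alpha < 1 ->
          energy_estimate Tb psib T dT psi alpha
      & exists Tinf : R, 0 <= Tinf /\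
        forall alpha : R, 0 < alpha < 1 ->
          let M := decay_const Tb psib alpha in
          [/\ forall x : R, 0 <= x ->
                `|T x - Tinf| <= M * expR (- (alpha * x)),
              forall x mu : R, 0 <= x -> 0 < mu <= 1 ->
                `|psi (x, mu) - Tinf ^+ 4| <=
                  `|psib mu - Tb ^+ 4| * expR (- (x / mu)) +
                  4 * (Tb + 2 * M) ^+ 3 * M * (1 - mu * alpha)^-1
                    * expR (- (alpha * x)),
              forall x mu : R, 0 <= x -> -1 <= mu < 0 ->
                `|psi (x, mu) - Tinf ^+ 4| <=
                  4 * (Tb + 2 * M) ^+ 3 * M * (1 - mu * alpha)^-1
                    * expR (- (alpha * x)),
              Tinf <= Tb + M
            & forall x : R, 0 <= x -> `|T x| <= Tb + 2 * M]].
Proof.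
have [B [N [mN N0 subN]]] := psib_bounded.
pose pb := psib \_ incoming.
(* With C >= 1 one has B <= C <= C^4, so the datum lies almost everywhere below the equilibrium
   intensity of temperature C. *)
pose C := Num.max 1 (Num.max Tb B).
have C1 : 1 <= C by rewrite le_max lexx.
have TbC : Tb <= C by rewrite !le_max lexx orbT.
have BC : B <= C ^+ 4.
  apply: (@le_trans _ _ C); first by rewrite !le_max lexx !orbT.
  by rewrite -[leLHS]expr1 ler_weXn2l.
have incP mu : incoming mu <-> 0 < mu <= 1 by rewrite /incoming/= in_itv.
have pbE mu : 0 < mu <= 1 -> pb mu = psib mu.
  by move=> /incP mu01; rewrite /pb patchE ifT// inE.
have mpb : measurable_fun setT pb.
  by apply/(measurable_restrictT _ _).1 => //; exact: measurable_itv.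
have pb_ge0 mu : 0 <= pb mu.
  rewrite /pb patchE; case: ifPn => //; rewrite inE => /incP; exact: psib_ge0.
have pb_neg mu : mu <= 0 -> pb mu = 0.
  move=> mu0; rewrite /pb patchE ifF//; apply/negbTE; rewrite notin_setE => /incP.
  by rewrite ltNge mu0.
(* The directions left out are 0 and some points of the null set [N]. The condition is put on [pb]
   rather than as avoidance of [N], which provides the bound at every point of [D]. *)
pose D : set R := directions `&` [set mu | mu != 0] `&` [set mu | pb mu <= C ^+ 4].
have mD : measurable D.
  apply: measurableI; first apply: measurableI; first exact: measurable_itv.
    have -> : [set mu : R | mu != 0] = ~` [set 0] by apply/seteqP; split => x /= /eqP.
    exact: measurableC.
  rewrite -[X in measurable X]setTI; apply: measurable_fun_le => //.
have D_directions : D `<=` directions by move=> mu [[]].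
have D_neq0 mu : D mu -> mu != 0 by move=> [[]].
have D_le mu : D mu -> pb mu <= C ^+ 4 by move=> [].
have D_full : lebesgue_measure (directions `\` D) = 0%E.
  have m0 : measurable [set (0 : R)] by exact: measurable_set1.
  apply: (@subset_measure0 _ _ _ lebesgue_measure _ ([set 0] `|` N)) => //.
  - by apply: measurableD => //; exact: measurable_itv.
  - exact: measurableU.
  - move=> mu [dmu nD]; have [->|mu0] := eqVneq mu 0; [by left|right].
    apply: subN => /= psibB; apply: nD; split; first by split.
    rewrite /= /pb patchE; case: ifPn => [|_]; last by rewrite exprn_ge0// (le_trans ler01).
    by rewrite inE => /incP /psibB h; exact: le_trans BC.
  - transitivity (@lebesgue_measure R [set 0]); last exact: lebesgue_measure_set1.
    exact: measureU0.
have [T [dT [bT T0 hT hdT]]] := exists_mild_solution Tb_ge0 TbC mpb pb_ge0 pb_neg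
  mD D_directions D_neq0 D_le.
exists T, dT, (fun z => rad pb (fun s => T s ^+ 4) z.1 z.2); split.
- exact: (solves_milne mpb pb_ge0 pb_neg pbE mD D_directions D_full D_neq0 D_le bT T0 hT hdT).
- exact: (solution_bounded_nonneg pb_ge0 pb_neg mD D_full D_neq0 D_le bT).
- move=> alpha.
  exact: (solution_energy_estimate Tb_ge0 mpb pb_ge0 pb_neg pbE mD D_directions D_full D_neq0 D_le bT T0 hT hdT).
- exact: (solution_decay Tb_ge0 mpb pb_ge0 pb_neg pbE mD D_directions D_full D_neq0 D_le bT T0 hT hdT).
Qed.
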